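(* Let $G$ be an infinite, locally finite, quasi-transitive graph on a countable vertex set $\mathbb{V}$, and let $J=(J_A)_{A\subset\mathbb{V},\,|A|\le2}$ be non-negative coupling constants such that $\sum_{A\ni v,\,|A|\le 2}J_A<\infty$ for every $v\in\mathbb{V}$ and $J_{\gamma A}=J_A$ for every $A$ and every automorphism $\gamma$ of $G$. Let $\mu^+$ and $\mu^-$ be the plus and minus infinite-volume Ising measures with coupling constants $J$. Let $\Gamma$ be any group acting quasi-transitively on $\mathbb{V}$ by automorphisms of $G$. Then $\mu^+$ and $\mu^-$ are $\Gamma$-fiid. In addition, if $\mu^+=\mu^-$, then $\mu^+$ is $\Gamma$-ffiid.
   Context: **Long-range Ising model.** For finite $V\subset\mathbb{V}$ and $\tau\in\{-1,+1\}^{\mathbb{V}}$, the Ising measure in $V$ with boundary conditions $\tau$ is $$\mu_V^\tau(\sigma)=\frac{\mathbf{1}_{\{\sigma_{\mathbb{V}\setminus V}=\tau_{\mathbb{V}\setminus V}\}}}{Z_V^\tau}\exp\Big[\sum_{A\subset\mathbb{V},\,|A|\le2,\,A\cap V\ne\emptyset}J_A\sigma_A\Big],\qquad\sigma\in\{-1,+1\}^{\mathbb{V}},$$ with $\sigma_A:=\prod_{v\in A}\sigma_v$ and $Z_V^\tau$ the normalizing constant. These measures are stochastically monotone in $\tau$ (pointwise order), so the weak limits $\mu^{\pm}:=\lim_{V\uparrow\mathbb{V}}\mu_V^{\pm}$ exist, where $\mu_V^{+}$ and $\mu_V^-$ correspond to $\tau\equiv+1$ and $\tau\equiv-1$; these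 are the largest and smallest Gibbs measures. **Codings.** Let $\mathrm{dist}$ be the graph distance in $G$. A group action is quasi-transitive if it has finitely many orbits. Let $\Gamma$ act quasi-transitively on $\mathbb{V}$ by automorphisms of $G$; it acts on configurations by $(\gamma\omega)_v=\omega_{\gamma^{-1}v}$. All probability spaces are standard. A coding from a $\Gamma$-invariant $T$-valued random field $Y=(Y_v)_{v\in \mathbb{V}}$ to a $\Gamma$-invariant $S$-valued random field $X=(X_v)_{v\in \mathbb{V}}$ is a measurable map $\varphi:T^{\mathbb{V}}\to S^{\mathbb{V}}$ such that $\varphi(Y)$ has the law of $X$ and $\varphi$ commutes with every element of $\Gamma$ on a $\Gamma$-invariant set of full measure. The coding radius $R_v(y)\in\{0,1,2,\dots\}\cup\{\infty\}$ is the minimal $r$ such that $\varphi(y)_v=\varphi(y')_v$ for every $y'$ with $y'_w=y_w$ for all $w$ with $\mathrm{dist}(v,w)\le r$ (up to modification on null sets). The coding is finitary if $R_v(Y)<\infty$ almost surely for all $v$. $X$ (or its law) is $\Gamma$-fiid if there is a coding from some i.i.d. process $Y$ (the $Y_v$ independent and identically distributed) to $X$, and $\Gamma$-ffiid if there is a finitary such coding.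
   Formalization: For the last claim (that μ⁺ is Γ-ffiid if μ⁺=μ⁻) the graph G is additionally assumed connected, so that the graph distance is finite; without this the claim fails, e.g. for Z plus two isolated vertices coupled to each other. *)

(* Defs.v *)
From HB Require Import structures.
From mathcomp Require Import all_boot all_order all_algebra finmap.
From mathcomp Require Import all_classical all_reals all_analysis.

Set Implicit Arguments.
Unset Strict Implicit.
Unset Printing Implicit Defensive.

Import Order.TTheory GRing.Theory Num.Theory.
Import numFieldNormedType.Exports.

Local Open Scope classical_set_scope.
Local Open Scope ring_scope.

Section Graphs.
Variables (V : eqType) (e : rel V).

Definition automorphism : set (V -> V) :=
  [set f | bijective f /\ forall v w, e (f v) (f w) = e v w].

Definition locally_finite : Prop := forall v, finite_set [set w | e v w].

Definition graph_connected : Prop :=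
  forall v w, exists2 p, path e v p & last v p = w.

(* [+oo] between distinct components. *)
Definition gdist (R : realType) (v w : V) : \bar R :=
  ereal_inf [set (size p)%:R%:E | p in [set p | path e v p /\ last v p = w]].

End Graphs.

Definition orbit_of (V : Type) (F : set (V -> V)) (v : V) : set V :=
  [set f v | f in F].

(* Meant for a group [F] of permutations of [V]. *)
Definition quasi_transitive (V : Type) (F : set (V -> V)) : Prop :=
  finite_set (range (orbit_of F)).

Definition is_group_action (Gamma : groupType) (V : Type)
    (act : Gamma -> V -> V) : Prop :=
  (forall v, act 1%g v = v) /\
  (forall g h v, act (g * h)%g v = act g (act h v)).

(* The product sigma-algebra on [V -> T]. *)
Definition coordinate_events (V : Type) d (T : measurableType d) :
    set (set (V -> T)) :=
  [set [set y | B.2 (y B.1)] | B in [set B : V * set T | measurable B.2]].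

Definition config (V : Type) d (T : measurableType d) :=
  g_sigma_algebraType (@coordinate_events V d T).

(* [T] is measurably isomorphic to a Polish space with its Borel sets. *)
Definition standard_borel (R : realType) d (T : measurableType d) : Prop :=
  exists P : completePseudoMetricType R,
    [/\ hausdorff_space P, @second_countable P &
     exists2 f : T -> P, bijective f &
       forall A : set P, <<s open >> A <-> measurable (f @^-1` A)].

Section Ising.
Variables (R : realType) (V : countType) (J : {fset V} -> R).

(* Spins are booleans: [true] is +1 and [false] is -1. *)
Definition spin (b : bool) : R := if b then 1 else -1.

Definition spin_prod (A : {fset V}) (s : V -> bool) : R :=
  \prod_(v <- A) spin (s v).

(* Sum of an absolutely summable real family. *)
Definition abs_sum (I : choiceType) (D : set I) (f : I -> R) : R :=
  fine (\esum_(i in D) (EFin \o f)^\+ i - \esum_(i in D) (EFin \o f)^\- i)%E.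

Definition interaction_sets (L : {fset V}) : set {fset V} :=
  [set A | (#|` A| <= 2)%N /\ (A `&` L)%fset != fset0].

Definition boltzmann (L : {fset V}) (tau s : V -> bool) : R :=
  \1_[set s' | forall v, v \notin L -> s' v = tau v] s *
  expR (abs_sum (interaction_sets L) (fun A => J A * spin_prod A s)).

(* Only finitely many terms of the sum are non-zero. *)
Definition partition_function (L : {fset V}) (tau : V -> bool) : R :=
  fine (\esum_(s in [set: V -> bool]) (boltzmann L tau s)%:E).

Definition ising_measure (L : {fset V}) (tau : V -> bool)
    (B : set (config V bool)) : \bar R :=
  \esum_(s in (B : set (V -> bool)))
     (boltzmann L tau s / partition_function L tau)%:E.

Lemma ising_mass_ge0 (L : {fset V}) (tau s : V -> bool) :
  (0 <= (boltzmann L tau s / partition_function L tau)%:E)%E.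
Proof.
have w0 s' : 0 <= boltzmann L tau s' by rewrite mulr_ge0// expR_ge0.
rewrite lee_fin divr_ge0// fine_ge0// esum_ge0// => s' _.
by rewrite lee_fin.
Qed.

Let ising0 L tau : ising_measure L tau set0 = 0%E.
Proof. exact: esum_set0. Qed.

Let ising_ge0 L tau B : (0 <= ising_measure L tau B)%E.
Proof. by apply: esum_ge0 => s _; exact: ising_mass_ge0. Qed.

Let ising_sigma_additive L tau : semi_sigma_additive (ising_measure L tau).
Proof.
move=> F mF tF mUF; rewrite /ising_measure nneseries_sum_bigcup//; last first.
  by move=> s; exact: ising_mass_ge0.
by apply: is_cvg_nneseries => n _ _; exact: ising_ge0.
Qed.

HB.instance Definition _ (L : {fset V}) (tau : V -> bool) :=
  isMeasure.Build _ (config V bool) R (ising_measure L tau)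
    (ising0 L tau) (ising_ge0 L tau) (@ising_sigma_additive L tau).

End Ising.

(* Finite subsets of [V] directed by inclusion. *)
Definition fset_up (V : choiceType) : set_system {fset V} :=
  filter_from [set: {fset V}] (fun L0 => [set L | (L0 `<=` L)%fset]).

Arguments fset_up V : clear implicits.

(* Continuity is for the product of the discrete topologies. *)
Definition weak_limit (R : realType) (V : choiceType)
    (mu_ : {fset V} -> {measure set (config V bool) -> \bar R})
    (mu : {measure set (config V bool) -> \bar R}) : Prop :=
  forall f : (V -> bool) -> R,
    continuous (f : {ptws V -> bool} -> R) ->
    (exists M, forall x, `|f x| <= M) ->
    (fun L => \int[mu_ L]_x f x) @ fset_up V --> \int[mu]_x f x.

Definition is_plus_ising (R : realType) (V : countType) (J : {fset V} -> R)
    (mu : probability (config V bool) R) : Prop :=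
  weak_limit (fun L => ising_measure J L (fun=> true)) mu.

Definition is_minus_ising (R : realType) (V : countType) (J : {fset V} -> R)
    (mu : probability (config V bool) R) : Prop :=
  weak_limit (fun L => ising_measure J L (fun=> false)) mu.

(* Random fields are represented by their laws. *)
Section Codings.
Variables (R : realType) (V : countType) (Gamma : groupType).
Variable act : Gamma -> V -> V.

Definition shift (T : Type) (g : Gamma) (y : V -> T) : V -> T :=
  fun v => y (act (g^-1)%g v).

Definition invariant_law d (T : measurableType d)
    (P : probability (config V T) R) : Prop :=
  forall (g : Gamma) (A : set (config V T)), measurable A ->
    P (@shift T g @^-1` A) = P A.

Definition iid_law d (T : measurableType d)
    (P : probability (config V T) R) : Prop :=
  exists nu : probability T R,
    forall (F : {fset V}) (B : V -> set T), (forall v, measurable (B v)) ->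
      P [set y | forall v, v \in F -> B v (y v)] = (\prod_(v <- F) nu (B v))%E.

Definition coding d (T : measurableType d) d' (S : measurableType d')
    (PY : probability (config V T) R) (PX : probability (config V S) R)
    (phi : config V T -> config V S) : Prop :=
  [/\ invariant_law PY, invariant_law PX, measurable_fun setT phi,
      forall A, measurable A -> PY (phi @^-1` A) = PX A &
      exists N : set (config V T),
        [/\ measurable N, PY N = 1%E,
            forall g, @shift T g @^-1` N = N &
            forall g y, N y -> phi (shift g y) = shift g (phi y)]].

Definition coding_radius (e : rel V) (T S : Type)
    (phi : (V -> T) -> V -> S) (v : V) (y : V -> T) : \bar R :=
  ereal_inf [set r%:R%:E | r in [set r : nat | forall y' : V -> T,
    (forall w, (gdist e R v w <= r%:R%:E)%E -> y' w = y w) ->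
    phi y v = phi y' v]].

(* Finiteness of the coding radius up to modification of [phi] on a null
   set. *)
Definition finitary (e : rel V) d (T : measurableType d)
    d' (S : measurableType d') (PY : probability (config V T) R)
    (phi : config V T -> config V S) : Prop :=
  exists phi' : config V T -> config V S,
    [/\ measurable_fun setT phi',
        {ae PY, forall y, phi' y = phi y} &
        forall v, {ae PY, forall y, (coding_radius e phi' v y < +oo)%E}].

Definition fiid d' (S : measurableType d')
    (PX : probability (config V S) R) : Prop :=
  exists d (T : measurableType d) (PY : probability (config V T) R)
    (phi : config V T -> config V S),
    [/\ standard_borel R T, iid_law PY & coding PY PX phi].

Definition ffiid (e : rel V) d' (S : measurableType d')
    (PX : probability (config V S) R) : Prop :=
  exists d (T : measurableType d) (PY : probability (config V T) R)
    (phi : config V T -> config V S),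
    [/\ standard_borel R T, iid_law PY, coding PY PX phi &
        finitary e PY phi].

End Codings.

(* Main.v *)
Require Import Defs.
From HB Require Import structures.
From mathcomp Require Import all_boot all_order all_algebra finmap.
From mathcomp Require Import all_classical all_reals all_analysis.
From mathcomp Require Import measurable_realfun.

Set Implicit Arguments.
Unset Strict Implicit.
Unset Printing Implicit Defensive.

Import Order.TTheory GRing.Theory Num.Theory.
Import numFieldNormedType.Exports.

Local Open Scope classical_set_scope.
Local Open Scope ring_scope.

(** In a finite window [L] with boundary spin [c], attach to every vertex a
    uniform label and an independent uniform height, and reveal the spins in the
    order of the labels, each one by comparing its height with the conditional
    probability of a [+] given the spins already revealed.  This samples exactly
    the Ising measure in [L].  By the four functions theorem the conditional
    probabilities are monotone in the frozen spins, so for the same randomness the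
    field with [+] boundary decreases when [L] grows, the field with [-] boundary
    increases, and the latter lies below the former.  The limits over all [L] do
    not depend on any exhaustion, hence commute with automorphisms, and have
    laws [mu^+] and [mu^-].  If these laws coincide, the two limits agree almost
    surely, so at each vertex some finite window already decides the spin. *)

(** * Sequential sampling of a finite spin system *)

(** A coding has to commute with [Gamma], so the order of revelation cannot come from an enumeration
    of [V]; labels attached to the vertices give an order that moves with them. In infinite volume
    this order is almost surely dense and has no first site, so spins cannot be revealed one after
    another there, and windows with a limit are unavoidable. Comparing windows then rests on two
    facts. The order in a window is the restriction of the order in a larger one. The conditional
    probability at a site, given all spins that are not still to be revealed, is the same in every
    window, because interactions avoiding the unrevealed sites cancel in it. A site outside a window
    thus acts as one revealed in advance with the boundary spin, and all comparisons become
    instances of one statement; the boundary spin being extremal fixes its direction. Equality of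
    two laws alone says nothing about two fields realising them. It is the order between the fields,
    under the same randomness, that turns it into almost sure equality. A deciding window is only a
    finite set; connectedness of the graph places it inside a ball. *)

Section Sampling.
Context {R : realFieldType} {V : choiceType}.
Implicit Types (s t a b : V -> bool) (v w : V) (l m : seq V).
Implicit Types W : (V -> bool) -> R.

Definition upd t v c : V -> bool := fun w => if w == v then c else t w.

Definition meet_conf a b : V -> bool := fun v => a v && b v.
Definition join_conf a b : V -> bool := fun v => a v || b v.

Definition eq_off l s t := forall v, v \notin l -> s v = t v.

Fixpoint fillings l t : seq (V -> bool) :=
  if l is v :: l' then fillings l' (upd t v false) ++ fillings l' (upd t v true)
  else [:: t].

Fixpoint pfun W l t : R :=
  if l is v :: l' then pfun W l' (upd t v false) + pfun W l' (upd t v true)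
  else W t.

(** The conditional probability of a + at [v] given the spins of [t] off [v :: l]: the sites of [l]
    come later in the order and are summed out. *)
Definition heat W v l t : R := pfun W l (upd t v true) / pfun W (v :: l) t.

Fixpoint sample (p : V -> seq V -> (V -> bool) -> R) l t (u : V -> R) :=
  if l is v :: l' then sample p l' (upd t v (u v < p v l' t)) u else t.

(** Recovers from the final configuration [s] the probability with which the height at [v] was
    compared. This works for a [p] that only reads spins frozen or revealed before [v], since [s]
    retains them. The value 0 off [l] is a mere default. *)
Fixpoint threshold (p : V -> seq V -> (V -> bool) -> R) l s v : R :=
  if l is w :: l' then (if v == w then p w l' s else threshold p l' s v)
  else 0.

Lemma upd_same t v : upd t v (t v) = t.
Proof. by apply/funext => w; rewrite /upd; case: eqP => // ->. Qed.

Lemma upd_id t v c : t v = c -> upd t v c = t.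
Proof. by move=> <-; exact: upd_same. Qed.

Lemma meet_upd a b v i j :
  meet_conf (upd a v i) (upd b v j) = upd (meet_conf a b) v (i && j).
Proof. by apply/funext => w; rewrite /meet_conf /upd; case: eqP. Qed.

Lemma join_upd a b v i j :
  join_conf (upd a v i) (upd b v j) = upd (join_conf a b) v (i || j).
Proof. by apply/funext => w; rewrite /join_conf /upd; case: eqP. Qed.

Lemma eq_off_upd l s t v : v \notin l ->
  eq_off (v :: l) s t <-> eq_off l s (upd t v (s v)).
Proof.
move=> vl; split => st w wl.
- rewrite /upd; case: eqP => [->//|/eqP wv].
  by apply: st; rewrite inE negb_or wv.
- move: wl; rewrite inE negb_or => /andP[wv wl].
  by rewrite st// /upd (negbTE wv).
Qed.

Lemma mem_fillings l s t : uniq l -> (s \in fillings l t) <-> eq_off l s t.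
Proof.
elim: l t => [|v l IH] t /=.
  rewrite inE; split => [/eqP -> //|st].
  by apply/eqP/funext => v; exact: st.
move=> /andP[vl ul]; rewrite mem_cat; split => [/orP[]|st].
- move=> /(IH _ ul) st; apply/eq_off_upd => //.
  by have := st _ vl; rewrite {1}/upd eqxx => svb; rewrite svb.
- move=> /(IH _ ul) st; apply/eq_off_upd => //.
  by have := st _ vl; rewrite {1}/upd eqxx => svb; rewrite svb.
- move/eq_off_upd : st => /(_ vl); case: (s v) => st; apply/orP.
  + by right; apply/(IH _ ul).
  + by left; apply/(IH _ ul).
Qed.

Lemma uniq_fillings l t : uniq l -> uniq (fillings l t).
Proof.
elim: l t => //= v l IH t /andP[vl ul]; rewrite cat_uniq !IH//= andbT.
apply/hasPn => s /(mem_fillings _ _ ul) /(_ _ vl) sv; apply/negP.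
move=> /(mem_fillings _ _ ul) /(_ _ vl); rewrite sv.
by rewrite /upd eqxx.
Qed.

Lemma pfunE W l t : pfun W l t = \sum_(s <- fillings l t) W s.
Proof.
elim: l t => [|v l IH] t /=; first by rewrite big_seq1.
by rewrite big_cat/= !IH.
Qed.

Lemma pfun_gt0 W l t : (forall s, 0 < W s) -> 0 < pfun W l t.
Proof. by move=> W0; elim: l t => //= v l IH t; rewrite addr_gt0. Qed.

Lemma pfun_off W l s t : eq_off l s t -> pfun W l s = pfun W l t.
Proof.
elim: l s t => [|v l IH] s t st /=; first by congr W; apply/funext => v; exact: st.
by congr (_ + _); apply: IH => w wl; rewrite /upd; case: eqP => // /eqP wv;
  apply: st; rewrite inE negb_or wv.
Qed.

Lemma pfun_scale W W' (c : (V -> bool) -> R) l t :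
  (forall s, W s = W' s * c s) -> (forall s s', eq_off l s s' -> c s = c s') ->
  pfun W l t = pfun W' l t * c t.
Proof.
move=> WW'; elim: l t => [|v l IH] t cc //=.
have cl s s' : eq_off l s s' -> c s = c s'.
  move=> ss'; apply: cc => w; rewrite inE negb_or => /andP[_ wl].
  exact: ss'.
have cv i : c (upd t v i) = c t.
  by apply: cc => w; rewrite inE negb_or /upd => /andP[/negbTE -> _].
by rewrite !IH// !cv mulrDl.
Qed.

Lemma heat_scale W W' (c : (V -> bool) -> R) v l t :
  (forall s, 0 < W s) -> (forall s, 0 < W' s) ->
  (forall s, W s = W' s * c s) ->
  (forall s s', eq_off (v :: l) s s' -> c s = c s') ->
  heat W v l t = heat W' v l t.
Proof.
move=> W0 W'0 WW' cc; have cl s s' : eq_off l s s' -> c s = c s'.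
  move=> ss'; apply: cc => w; rewrite inE negb_or => /andP[_ wl].
  exact: ss'.
have cv : c (upd t v true) = c t.
  by apply: cc => w; rewrite inE negb_or /upd => /andP[/negbTE -> _].
have c0 : c t != 0.
  by apply/eqP => c0; have := W0 t; rewrite WW' c0 mulr0 ltxx.
rewrite /heat (pfun_scale _ WW' cl) (pfun_scale _ WW' cc) cv.
by rewrite invfM mulrACA divff// mulr1.
Qed.

Lemma heat_off W v l s t : eq_off (v :: l) s t -> heat W v l s = heat W v l t.
Proof.
move=> st; rewrite /heat (pfun_off W st); congr (_ / _).
apply: pfun_off => w wl; rewrite /upd; case: eqP => // /eqP wv.
by apply: st; rewrite inE negb_or wv.
Qed.

Lemma heat_compl W v l t : (forall s, 0 < W s) ->
  1 - heat W v l t = pfun W l (upd t v false) / pfun W (v :: l) t.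
Proof.
move=> W0; have /lt0r_neq0 Z0 := pfun_gt0 (v :: l) t W0.
by rewrite /heat -[X in X - _](divff Z0) -mulrBl /= addrK.
Qed.

Lemma heat_itv W v l t : (forall s, 0 < W s) -> 0 <= heat W v l t <= 1.
Proof.
move=> W0; apply/andP; split.
  by rewrite divr_ge0// ltW// pfun_gt0.
by rewrite -subr_ge0 heat_compl// divr_ge0// ltW// pfun_gt0.
Qed.

(* The one-site case of the Ahlswede-Daykin four functions theorem. *)
Lemma four_functions1 (a0 a1 b0 b1 c0 c1 d0 d1 : R) :
  0 < a0 -> 0 < a1 -> 0 < b0 -> 0 < b1 ->
  0 < c0 -> 0 < c1 -> 0 < d0 -> 0 < d1 ->
  a0 * b0 <= c0 * d0 -> a0 * b1 <= c0 * d1 -> a1 * b0 <= c0 * d1 ->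
  a1 * b1 <= c1 * d1 -> (a0 + a1) * (b0 + b1) <= (c0 + c1) * (d0 + d1).
Proof.
move=> a00 a10 b00 b10 c00 c10 d00 d10 h00 h01 h10 h11.
have z0 : 0 < c0 * d1 by rewrite mulr_gt0.
have xy : (a0 * b1) * (a1 * b0) <= (c0 * d1) * (c1 * d0).
  rewrite mulrACA [b1 * b0]mulrC mulrACA.
  rewrite [leRHS]mulrACA [d1 * d0]mulrC [leRHS]mulrACA.
  by apply: ler_pM => //; rewrite mulr_ge0// ltW.
(* Put [x = a0 * b1], [y = a1 * b0] and [z = c0 * d1]. Both [x] and [y] are at most [z], so
   [(z - x) * (z - y) >= 0] gives [z * (x + y) <= z * z + x * y]; then [xy] bounds the last term and
   [z] is cancelled. *)
have h : a0 * b1 + a1 * b0 <= c0 * d1 + c1 * d0.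
  rewrite -(ler_pM2l z0); apply: le_trans (_ : (c0 * d1) * (c0 * d1) +
    (a0 * b1) * (a1 * b0) <= _); last by rewrite [leRHS]mulrDr lerD2l.
  move: h01 h10; set x := a0 * b1; set y := a1 * b0; set z := c0 * d1 => xz yz.
  have : 0 <= (z - x) * (z - y) by rewrite mulr_ge0// subr_ge0.
  rewrite mulrBl !mulrBr opprB addrACA [- (z * y) - _]addrC -opprD subr_ge0.
  by rewrite mulrDr [z * x]mulrC.
by rewrite !mulrDl !mulrDr -!addrA lerD// !addrA lerD.
Qed.

Definition log_supermodular W :=
  forall a b, W a * W b <= W (meet_conf a b) * W (join_conf a b).

(** The windows [L] and [L'] may differ. At a site in both, the one-site case applies. At a site
    missing from [L] the spin of [a] is frozen at -, at a site missing from [L'] that of [b] is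
    frozen at +; the meet, respectively the join, is frozen at the same value, so only one factor on
    each side splits and two of the four inductive inequalities add up. *)
Lemma pfun_supermodular W (L L' : pred V) m a b :
  (forall s, 0 < W s) -> log_supermodular W -> uniq m ->
  {in m, forall v, L v || ~~ a v} -> {in m, forall v, L' v || b v} ->
  pfun W [seq w <- m | L w] a * pfun W [seq w <- m | L' w] b <=
  pfun W [seq w <- m | L w] (meet_conf a b) * pfun W [seq w <- m | L' w] (join_conf a b).
Proof.
move=> W0 Wsm; elim: m a b => [|v m IH] a b /=; first by move=> _ _ _; exact: Wsm.
move=> /andP[vm um] aL bL'.
have aLm i : {in m, forall w, L w || ~~ upd a v i w}.
  move=> w wm; rewrite /upd; case: eqP => [wv|_]; first by rewrite -wv wm in vm.
  by apply: aL; rewrite inE wm orbT.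
have bLm i : {in m, forall w, L' w || upd b v i w}.
  move=> w wm; rewrite /upd; case: eqP => [wv|_]; first by rewrite -wv wm in vm.
  by apply: bL'; rewrite inE wm orbT.
have IHij i j := IH _ _ um (aLm i) (bLm j).
have {}IHij i j : pfun W [seq w <- m | L w] (upd a v i) *
    pfun W [seq w <- m | L' w] (upd b v j) <=
    pfun W [seq w <- m | L w] (upd (meet_conf a b) v (i && j)) *
    pfun W [seq w <- m | L' w] (upd (join_conf a b) v (i || j)).
  by rewrite -meet_upd -join_upd.
have a_v : ~~ L v -> a v = false.
  by move=> Lv; have := aL v; rewrite mem_head (negbTE Lv) => /(_ isT) /negbTE.
have b_v : ~~ L' v -> b v = true.
  by move=> Lv; have := bL' v; rewrite mem_head (negbTE Lv) => /(_ isT).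
case: ifPn => Lv; case: ifPn => L'v /=.
- by apply: four_functions1; rewrite ?pfun_gt0//; exact: IHij.
- have bv := b_v L'v.
  have jv : join_conf a b v = true by rewrite /join_conf bv orbT.
  have := IHij false true; have := IHij true true => /=.
  by rewrite (upd_id bv) (upd_id jv) => ? ?; rewrite !mulrDl lerD.
- have av := a_v Lv.
  have mv : meet_conf a b v = false by rewrite /meet_conf av.
  have := IHij false false; have := IHij false true => /=.
  by rewrite (upd_id av) (upd_id mv) => ? ?; rewrite !mulrDr lerD.
- by apply: IH => // w wm; [apply: aL|apply: bL']; rewrite inE wm orbT.
Qed.

(** Cross-multiplying cancels the term with a + at [v] on both sides. What remains is
    [pfun_supermodular] for [a] with a + and [b] with a - at [v]: as [a] lies below [b], meet and
    join merely exchange these two spins. *)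
Lemma heat_le W (L L' : pred V) v m a b :
  (forall s, 0 < W s) -> log_supermodular W -> uniq (v :: m) ->
  (forall w, a w ==> b w) ->
  {in m, forall v, L v || ~~ a v} -> {in m, forall v, L' v || b v} ->
  heat W v [seq w <- m | L w] a <= heat W v [seq w <- m | L' w] b.
Proof.
move=> W0 Wsm /=/andP[vm um] ab aL bL.
rewrite ler_pdivrMr ?pfun_gt0// mulrAC ler_pdivlMr ?pfun_gt0//=.
rewrite !mulrDr [X in _ <= _ + X]mulrC lerD2r.
have aLm i : {in m, forall w, L w || ~~ upd a v i w}.
  move=> w wm; rewrite /upd; case: eqP => [wv|_]; first by rewrite -wv wm in vm.
  exact: aL.
have bLm i : {in m, forall w, L' w || upd b v i w}.
  move=> w wm; rewrite /upd; case: eqP => [wv|_]; first by rewrite -wv wm in vm.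
  exact: bL.
rewrite [leRHS]mulrC.
have := pfun_supermodular W0 Wsm um (aLm true) (bLm false).
have -> : meet_conf (upd a v true) (upd b v false) = upd a v false.
  apply/funext => w; rewrite /meet_conf /upd; case: eqP => //= _.
  by have := ab w; case: (a w); case: (b w).
have -> // : join_conf (upd a v true) (upd b v false) = upd b v true.
apply/funext => w; rewrite /join_conf /upd; case: eqP => //= _.
by have := ab w; case: (a w); case: (b w).
Qed.

End Sampling.

(** * Monotone coupling and exact law of the sequential sampler *)

Section HeatSampling.
Context {R : realFieldType} {V : choiceType}.
Implicit Types (s t : V -> bool) (v w : V) (k l m : seq V) (u : V -> R).
Variable W : seq V -> (V -> bool) -> R.

(* The part of the energy that does not meet [l] is a constant factor, so the
   conditional law of the spins in [l] does not depend on the window [k]. *)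
Definition window_factor := forall k l, {subset l <= k} ->
  exists c : (V -> bool) -> R, (forall s, W k s = W l s * c s) /\
    (forall s s', eq_off l s s' -> c s = c s').

Hypothesis W_gt0 : forall k s, 0 < W k s.
Hypothesis W_factor : window_factor.

Definition site_prob v l t := heat (W (v :: l)) v l t.

(** Turns probabilities coming from two windows into values of one common weight, as [heat_le]
    requires. *)
Lemma site_probE k v l t : {subset v :: l <= k} ->
  site_prob v l t = heat (W k) v l t.
Proof.
move=> /W_factor[c [Wc cc]]; rewrite /site_prob.
by rewrite (heat_scale t (W_gt0 k) (W_gt0 (v :: l)) Wc cc).
Qed.

Lemma sample_off l t u : eq_off l (sample site_prob l t u) t.
Proof.
elim: l t => //= v l IH t w; rewrite inE negb_or => /andP[wv wl].
by rewrite IH// /upd (negbTE wv).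
Qed.

(** Filtering both lists from one [m] keeps the two runs synchronised. A site in both windows is
    settled by [heat_le] with the same height; a site in only one window already has the extreme
    spin in the other run, - below or + above. Comparing - with + boundary, and nested windows with
    equal boundary, are all instances. *)
Lemma sample_le (L L' : pred V) m s t u :
  (forall k, log_supermodular (W k)) -> uniq m -> (forall w, s w ==> t w) ->
  {in m, forall v, L v || ~~ s v} -> {in m, forall v, L' v || t v} ->
  forall w, sample site_prob [seq v <- m | L v] s u w ==>
            sample site_prob [seq v <- m | L' v] t u w.
Proof.
move=> Wsm; elim: m s t => //= v m IH s t /andP[vm um] st sL tL'.
have sLm : {in m, forall w, L w || ~~ s w}.
  by move=> w wm; apply: sL; rewrite inE wm orbT.
have tLm : {in m, forall w, L' w || t w}.
  by move=> w wm; apply: tL'; rewrite inE wm orbT.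
have updm r i w : w \in m -> upd r v i w = r w.
  by rewrite /upd; case: eqP => // ->; rewrite (negbTE vm).
have svm i : {in m, forall w, L w || ~~ upd s v i w}.
  by move=> w wm; rewrite updm// sLm.
have tvm i : {in m, forall w, L' w || upd t v i w}.
  by move=> w wm; rewrite updm// tLm.
have sub (P : pred V) : {subset v :: [seq w <- m | P w] <= v :: m}.
  move=> w; rewrite !inE => /orP[->//|]; rewrite mem_filter => /andP[_ ->].
  exact: orbT.
case: ifPn => Lv; case: ifPn => L'v /=.
- apply: IH => // w; rewrite /upd; case: eqP => // _.
  rewrite (site_probE _ (sub L)) (site_probE _ (sub L')); apply/implyP.
  move=> /lt_le_trans; apply; apply: heat_le => //=; exact/andP.
- apply: IH => // w; rewrite /upd; case: eqP => [->|//].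
  by have := tL' v; rewrite mem_head (negbTE L'v) => /(_ isT) /= ->; rewrite implybT.
- apply: IH => // w; rewrite /upd; case: eqP => [->|//].
  by have := sL v; rewrite mem_head (negbTE Lv) => /(_ isT) /= /negbTE ->.
- exact: IH.
Qed.

(** Once the outcome [s] is prescribed, the thresholds are numbers determined by [s], so the event
    splits into one condition per height. This is what makes its probability a product. *)
Lemma sampleP l s t u : uniq l ->
  sample site_prob l t u = s <->
  eq_off l s t /\ {in l, forall v, (u v < threshold site_prob l s v) = s v}.
Proof.
elim: l t => [|v l IH] t /=.
  move=> _; split => [->//|[st _]]; apply/funext => v; exact/esym/st.
move=> /andP[vl ul]; rewrite IH//.
have thr w : w \in l ->
    (if w == v then site_prob v l s else threshold site_prob l s w) =
    threshold site_prob l s w.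
  by case: eqP => // ->; rewrite (negbTE vl).
split => [[st sl]|[st sl]].
- have sv := st _ vl; rewrite {1}/upd eqxx in sv.
  have st' : eq_off (v :: l) s t by apply/eq_off_upd => //; rewrite sv.
  split=> // w; rewrite inE => /orP[/eqP ->|wl]; last by rewrite thr// sl.
  by rewrite eqxx [RHS]sv /site_prob (heat_off (W (v :: l)) st').
- have st' : eq_off l s (upd t v (s v)) by apply/eq_off_upd.
  have := sl v (mem_head _ _); rewrite eqxx.
  rewrite /site_prob (heat_off (W (v :: l)) st) => ->; split=> // w wl.
  by rewrite -sl ?thr// inE wl orbT.
Qed.

Lemma threshold_itv l s v : 0 <= threshold site_prob l s v <= 1.
Proof.
elim: l => /= [|w l IH]; first by rewrite lexx ler01.
by case: ifP => // _; exact: heat_itv.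
Qed.

(* The product telescopes. *)
Lemma threshold_prod k l s t : uniq l -> {subset l <= k} -> eq_off l s t ->
  \prod_(v <- l) (if s v then threshold site_prob l s v
                  else 1 - threshold site_prob l s v) =
  W k s / pfun (W k) l t.
Proof.
elim: l t => [|v l IH] t /=.
  move=> _ _ st; rewrite big_nil (_ : t = s) ?divff// ?lt0r_neq0//.
  by apply/funext => v; exact/esym/st.
move=> /andP[vl ul] lk st; rewrite big_cons eqxx.
have lk' : {subset l <= k} by move=> w wl; apply: lk; rewrite inE wl orbT.
have st' : eq_off l s (upd t v (s v)) by apply/eq_off_upd.
rewrite (eq_big_seq (fun w => if s w then threshold site_prob l s w
  else 1 - threshold site_prob l s w)); last first.
  by move=> w wl; case: eqP => // wv; rewrite -wv wl in vl.
rewrite (IH _ ul lk' st') (site_probE _ lk) (heat_off (W k) st).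
rewrite (heat_compl _ _ _ (W_gt0 k)) /heat.
have Z0 c := lt0r_neq0 (pfun_gt0 l (upd t v c) (W_gt0 k)).
by case: (s v) => /=; rewrite mulrC -mulrA; congr (_ * _); rewrite mulKf.
Qed.

End HeatSampling.

(** * Relabelling of the sites *)

Section Equivariance.
Context {R : realFieldType} {V : choiceType}.
Implicit Types (s t : V -> bool) (v w : V) (l : seq V) (u : V -> R).
Variables (W : seq V -> (V -> bool) -> R) (f g : V -> V).
Hypotheses (fK : cancel f g) (gK : cancel g f).
Hypothesis W_map : forall l s, W (map f l) (s \o g) = W l s.

Lemma upd_comp t v c : upd (t \o g) (f v) c = upd t v c \o g.
Proof.
by apply/funext => w; rewrite /upd /= -(can_eq gK w) fK.
Qed.

Lemma pfun_map k l t :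
  pfun (W (map f k)) (map f l) (t \o g) = pfun (W k) l t.
Proof.
elim: l t => [|v l IH] t /=; first exact: W_map.
by rewrite !upd_comp !IH.
Qed.

Lemma site_prob_map v l t :
  site_prob W (f v) (map f l) (t \o g) = site_prob W v l t.
Proof.
by rewrite /site_prob /heat upd_comp -!map_cons !pfun_map.
Qed.

Lemma sample_map l t u :
  sample (site_prob W) (map f l) (t \o g) (u \o g) =
  sample (site_prob W) l t u \o g.
Proof.
by elim: l t => //= v l IH t; rewrite site_prob_map fK upd_comp IH.
Qed.

End Equivariance.

(** * The Ising weight *)

Section Energy.
Context {R : realType} {V : countType}.
Variable J : {fset V} -> R.
Hypothesis J_ge0 : forall A : {fset V}, (#|` A| <= 2)%N -> 0 <= J A.
Hypothesis J_summable : forall v : V,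
  (\esum_(A in [set A : {fset V} | v \in A /\ (#|` A| <= 2)%N]) (J A)%:E
    < +oo)%E.
Implicit Types (K L : {fset V}) (s t a b : V -> bool) (D : set {fset V}).

Definition energy K s : R :=
  abs_sum (interaction_sets K) (fun A => J A * spin_prod R A s).

Definition window_weight (l : seq V) s : R := expR (energy [fset x in l]%fset s).

(* The frustration of [s]: a non-negative substitute for [- energy]. *)
Definition defect D s : R :=
  fine (\esum_(A in D) (J A * (1 - spin_prod R A s))%:E).

(** A set meeting [K] contains one of the finitely many sites of [K], so the sum is at most the sum
    over [K] of the one-site sums. *)
Lemma interaction_summable K :
  (\esum_(A in interaction_sets K) (J A)%:E < +oo)%E.
Proof.
have J0 v A : interaction_sets K A -> (0 <= if v \in A then (J A)%:E else 0)%E.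
  by move=> [A2 _]; case: ifP => // _; rewrite lee_fin J_ge0.
apply: (@le_lt_trans _ _ (\esum_(A in interaction_sets K)
    \sum_(v <- K) if v \in A then (J A)%:E else 0)%E).
  apply: le_esum => A IA; have [A2 /fset0Pn[v]] := IA.
  rewrite in_fsetI => /andP[vA vK].
  rewrite (big_fsetD1 v)//= vA leeDl// sume_ge0// => w _; exact: J0.
rewrite esum_sum; last by move=> A v IA _; exact: J0.
apply: lte_sum_pinfty => v _; apply: le_lt_trans (J_summable v).
rewrite esum_mkcond [leRHS]esum_mkcond; apply: le_esum => A _.
case: ifPn => [/set_mem[A2 _]|_]; last first.
  by case: ifPn => // /set_mem[_ A2]; rewrite lee_fin J_ge0.
case: ifPn => vA; first by rewrite mem_set.
by case: ifPn => // _; rewrite lee_fin J_ge0.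
Qed.

Lemma spin_prod_itv A s : -1 <= spin_prod R A s <= 1.
Proof.
rewrite -ler_norml /spin_prod normr_prod big1// => v _.
by rewrite /spin; case: (s v); rewrite ?normrN normr1.
Qed.

Lemma defect_ge0 A s : (#|` A| <= 2)%N -> 0 <= J A * (1 - spin_prod R A s).
Proof.
by move=> /J_ge0 JA; rewrite mulr_ge0// subr_ge0; case/andP: (spin_prod_itv A s).
Qed.

Lemma defect_fin D K s : D `<=` interaction_sets K ->
  \esum_(A in D) (J A * (1 - spin_prod R A s))%:E \is a fin_num.
Proof.
move=> DK; rewrite ge0_fin_numE; last first.
  by apply: esum_ge0 => A /DK[A2 _]; rewrite lee_fin defect_ge0.
apply: (@le_lt_trans _ _ (\esum_(A in interaction_sets K) (J A)%:E +
    \esum_(A in interaction_sets K) (J A)%:E)%E); last first.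
  by rewrite lte_add_pinfty// interaction_summable.
rewrite -esumD; try by move=> A [A2 _]; rewrite lee_fin J_ge0.
rewrite esum_mkcond [leRHS]esum_mkcond; apply: le_esum => A _.
case: ifPn => [/set_mem /DK AK|_]; last first.
  by case: ifPn => // /set_mem[A2 _]; rewrite adde_ge0// lee_fin J_ge0.
rewrite mem_set// -EFinD lee_fin -[in leRHS](mulr1 (J A)) -mulrDr.
case: AK => A2 _; rewrite ler_wpM2l ?J_ge0// lerD2l lerNl.
by case/andP: (spin_prod_itv A s).
Qed.

(** Writing [J A * spin_prod R A s] as [J A] minus [J A * (1 - spin_prod R A s)] leaves two sums of
    non-negative terms, which can be compared, split and reindexed freely; only the second depends
    on [s]. *)
Lemma energyE K s : energy K s =
  fine (\esum_(A in interaction_sets K) (J A)%:E) - defect (interaction_sets K) s.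
Proof.
rewrite /energy /abs_sum /defect.
have -> : EFin \o (fun A => J A * spin_prod R A s) =
    ((fun A => (J A)%:E) \- (fun A => (J A * (1 - spin_prod R A s))%:E))%E.
  apply/funext => A /=; rewrite -EFinB; congr EFin.
  by rewrite mulrBr mulr1 opprB addrC subrK.
have fJ : \esum_(A in interaction_sets K) (J A)%:E \is a fin_num.
  rewrite ge0_fin_numE ?interaction_summable// esum_ge0// => A [A2 _].
  by rewrite lee_fin J_ge0.
have fd := defect_fin s (@subset_refl _ (interaction_sets K)).
rewrite esumB ?fineB//.
- rewrite summableE (eq_esum (b := fun A => (J A)%:E))// => A [A2 _].
  by rewrite gee0_abs// lee_fin J_ge0.
- rewrite summableE (eq_esum (b := fun A => (J A * (1 - spin_prod R A s))%:E))//.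
  by move=> A [A2 _]; rewrite gee0_abs// lee_fin defect_ge0.
- by move=> A [A2 _]; rewrite lee_fin J_ge0.
- by move=> A [A2 _]; rewrite lee_fin defect_ge0.
Qed.

(** Equality holds unless [A] has two sites at which [a] and [b] are ordered in opposite ways; then
    the left side is -2 and the right side 2. Multiplied by couplings [J A >= 0], this is how
    ferromagnetism enters. *)
Lemma spin_prod_supermodular A a b : (#|` A| <= 2)%N ->
  spin_prod R A a + spin_prod R A b <=
  spin_prod R A (meet_conf a b) + spin_prod R A (join_conf a b).
Proof.
have two : (0 : R) <= 1 + 1 by rewrite addr_ge0.
have mtwo : -1 - 1 <= (0 : R) by rewrite -opprD oppr_le0.
have mtwo' : -1 - 1 <= (1 + 1 : R) by rewrite (le_trans mtwo).
rewrite /spin_prod; move: (enum_fset A) => [|x [|y []]]//= _;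
  rewrite !(big_nil, big_cons) ?mulr1 /spin /meet_conf /join_conf//.
  by case: (a x) (b x) => [] [] /=; rewrite ?subrr ?addNr ?lexx.
by case: (a x) (b x) (a y) (b y) => [] [] [] [] /=;
  rewrite ?mulrN1 ?mulN1r ?mulr1 ?opprK ?subrr ?addNr ?lexx.
Qed.

Lemma energy_supermodular K a b :
  energy K a + energy K b <= energy K (meet_conf a b) + energy K (join_conf a b).
Proof.
rewrite !energyE addrACA [leRHS]addrACA lerD2l -!opprD lerN2 /defect.
rewrite -!fineD ?(defect_fin _ (@subset_refl _ (interaction_sets K)))//.
rewrite fine_le ?fin_numD ?(defect_fin _ (@subset_refl _ (interaction_sets K)))//.
rewrite -!esumD; try by move=> A [A2 _]; rewrite lee_fin defect_ge0.
apply: le_esum => A [A2 _]; rewrite -!EFinD lee_fin -!mulrDr.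
rewrite ler_wpM2l ?J_ge0// addrACA [leRHS]addrACA lerD2l -!opprD lerN2.
exact: spin_prod_supermodular.
Qed.

Lemma window_weight_gt0 l s : 0 < window_weight l s.
Proof. exact: expR_gt0. Qed.

Lemma window_weight_supermodular l : log_supermodular (window_weight l).
Proof. by move=> a b; rewrite -!expRD ler_expR energy_supermodular. Qed.

Lemma window_weight_factor : window_factor window_weight.
Proof.
move=> k l lk; set I := interaction_sets (V := V); set Kk := [fset x in k]%fset.
set Kl := [fset x in l]%fset.
have IlIk : I Kl `<=` I Kk.
  move=> A [A2 /fset0Pn[v]]; rewrite !inE => /andP[vA vl]; split => //.
  by apply/fset0Pn; exists v; rewrite !inE vA lk.
(* The interactions that meet [k] but avoid [l]: they only see spins off [l] and make up the
   factor. *)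
pose D := I Kk `&` ~` I Kl.
exists (fun s => expR (fine (\esum_(A in D) (J A)%:E) - defect D s)).
have Dk : D `<=` I Kk by move=> A [].
have fJ D' : D' `<=` I Kk -> \esum_(A in D') (J A)%:E \is a fin_num.
  move=> D'k; rewrite ge0_fin_numE.
    apply: le_lt_trans (interaction_summable Kk).
    rewrite esum_mkcond [leRHS]esum_mkcond; apply: le_esum => A _.
    case: ifPn => [/set_mem/D'k AK|_]; first by rewrite mem_set.
    by case: ifPn => // /set_mem[A2 _]; rewrite lee_fin J_ge0.
  by apply: esum_ge0 => A /D'k[A2 _]; rewrite lee_fin J_ge0.
split=> [s|s s' ss'].
  rewrite /window_weight -expRD !energyE; congr expR.
  rewrite addrACA -opprD /defect -!fineD ?fJ ?(defect_fin _ Dk)//; last first.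
    exact: (defect_fin _ IlIk).
  congr (fine _ - fine _).
    rewrite (esumID (I Kl))//; last by move=> A [A2 _]; rewrite lee_fin J_ge0.
    by rewrite (setIidr IlIk).
  rewrite (esumID (I Kl))//; last by move=> A [A2 _]; rewrite lee_fin defect_ge0.
  by rewrite (setIidr IlIk).
congr (expR (_ - fine _)); apply: eq_esum => A [[A2 _] AKl].
congr (_ * (1 - _))%:E; apply: eq_big_seq => v vA; rewrite ss'//.
apply/negP => vl; apply: AKl; split => //; apply/fset0Pn; exists v.
by rewrite !inE vA.
Qed.

Lemma window_weight_map (f g : V -> V) l s : cancel f g -> cancel g f ->
  (forall A : {fset V}, (#|` A| <= 2)%N -> J [fset f v | v in A]%fset = J A) ->
  window_weight (map f l) (s \o g) = window_weight l s.
Proof.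
move=> fK gK Jf; congr expR; rewrite !energyE.
pose F (A : {fset V}) := [fset f v | v in A]%fset.
have finj : injective f := can_inj fK.
have FI : set_bij (interaction_sets [fset x in l]%fset)
    (interaction_sets [fset x in map f l]%fset) F.
  have Ff (A : {fset V}) v : (f v \in F A) = (v \in A).
    by apply/imfsetP/idP => [[w wA /finj ->//]|vA]; exists v.
  have cF (A : {fset V}) : #|` F A| = #|` A| by rewrite card_imfset.
  split.
  - move=> A [A2 /fset0Pn[v]]; rewrite !inE => /andP[vA vl]; split.
      by rewrite cF.
    by apply/fset0Pn; exists (f v); rewrite !inE Ff vA map_f.
  - move=> A B _ _ AB; apply/fsetP => v; by rewrite -Ff AB Ff.
  - move=> B [B2 /fset0Pn[v]]; rewrite !inE => /andP[vB /mapP[w wl vfw]].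
    have FB : F [fset g v | v in B]%fset = B.
      apply/fsetP => x; rewrite -[x]gK Ff gK; apply/imfsetP/idP => /=.
        by move=> [y yB /(can_inj gK) ->].
      by move=> xB; exists x.
    exists [fset g v | v in B]%fset => //; split; first by rewrite -cF FB.
    apply/fset0Pn; exists w; rewrite !inE wl andbT -[w]fK -vfw.
    by apply/imfsetP; exists v.
have spF A : spin_prod R (F A) (s \o g) = spin_prod R A s.
  rewrite /spin_prod /F big_imfset//=; last by move=> x y _ _; exact: finj.
  by apply: eq_bigr => v _; rewrite fK.
rewrite /defect !(reindex_esum _ _ _ _ FI); congr (fine _ - fine _).
  by apply: eq_esum => A [A2 _]; rewrite Jf.
by apply: eq_esum => A [A2 _]; rewrite Jf// spF.
Qed.

End Energy.

(** * Finite-volume Ising measures as finite sums *)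

Section FiniteVolume.
Context {R : realType} {V : countType}.
Variable J : {fset V} -> R.
Implicit Types (s t : V -> bool) (l : seq V).

Lemma esum_seq (I : choiceType) (r : seq I) (C : set I) (a : I -> \bar R) :
  uniq r -> (forall i, 0 <= a i)%E -> (forall i, i \notin r -> a i = 0%E) ->
  \esum_(i in C) a i = (\sum_(i <- r | i \in C) a i)%E.
Proof.
move=> ur a0 ar; rewrite (esumID [set` r])// [X in (_ + X)%E]esum1 ?adde0; last first.
  by move=> i [_ /negP/ar].
rewrite setIC esum_mkcondr esum_fset//; last first.
  by move=> i _; case: ifP.
by rewrite -fsbig_seq// [RHS]big_mkcond.
Qed.

Lemma boltzmannE l t s :
  boltzmann J [fset x in l]%fset t s =
  \1_[set s' | eq_off l s' t] s * window_weight J l s.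
Proof.
rewrite /boltzmann /window_weight /energy; congr (\1__ _ * _).
apply/seteqP; split => s' /= h v vl; apply: h; first by rewrite inE.
by move: vl; rewrite inE.
Qed.

Lemma boltzmann_in l t s : eq_off l s t ->
  boltzmann J [fset x in l]%fset t s = window_weight J l s.
Proof. by move=> st; rewrite boltzmannE indicE mem_set// mul1r. Qed.

Lemma boltzmann_out l t s : uniq l -> s \notin fillings l t ->
  boltzmann J [fset x in l]%fset t s = 0.
Proof.
move=> ul sl; rewrite boltzmannE indicE memNset ?mul0r// => st.
by move/negP : sl; apply; apply/mem_fillings.
Qed.

Lemma partition_functionE l t : uniq l ->
  partition_function J [fset x in l]%fset t = pfun (window_weight J l) l t.
Proof.
move=> ul; rewrite /partition_function (@esum_seq _ (fillings l t)).
- rewrite (eq_bigl xpredT); last by move=> s; rewrite in_setT.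
  rewrite sumEFin/= pfunE; apply: eq_big_seq => s.
  by move=> /(mem_fillings _ _ ul)/boltzmann_in.
- exact: uniq_fillings.
- by move=> s; rewrite lee_fin boltzmannE mulr_ge0// expR_ge0.
- by move=> s sl; rewrite boltzmann_out.
Qed.

Lemma ising_measureE l t C : uniq l ->
  ising_measure J [fset x in l]%fset t C =
  (\sum_(s <- fillings l t | s \in C)
     (window_weight J l s / pfun (window_weight J l) l t)%:E)%E.
Proof.
move=> ul; rewrite /ising_measure partition_functionE//.
rewrite (@esum_seq _ (fillings l t)).
- rewrite [LHS]big_seq_cond [RHS]big_seq_cond; apply: eq_bigr => s /andP[sl _].
  by rewrite boltzmann_in//; apply/(mem_fillings _ _ ul).
- exact: uniq_fillings.
- move=> s; rewrite lee_fin boltzmannE divr_ge0//.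
    by rewrite mulr_ge0// expR_ge0.
  by rewrite ltW// pfun_gt0// => ?; exact: window_weight_gt0.
- by move=> s sl; rewrite boltzmann_out// mul0r.
Qed.

End FiniteVolume.

(** * Measures on configurations *)

Section ConfigMeasures.
Context {R : realType} {V : countType} d {T : measurableType d}.

Definition cylinder (F : {fset V}) (B : V -> set T) : set (config V T) :=
  [set y | forall v, v \in F -> B v (y v)].

Lemma measurable_coord v : measurable_fun setT (fun y : config V T => y v).
Proof.
move=> _ B mB; rewrite setTI; apply: sub_sigma_algebra.
by exists (v, B).
Qed.

Lemma cylinder_setI F B F' B' : cylinder F B `&` cylinder F' B' =
  cylinder (F `|` F')%fset (fun v =>
    (if v \in F then B v else setT) `&` (if v \in F' then B' v else setT)).
Proof.
apply/seteqP; split => [y [yF yF'] v _|y yFF'].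
  by split; case: ifP => //; [exact: yF|exact: yF'].
split=> v vF; have := yFF' v; rewrite inE vF ?orbT => /(_ isT)[].
  by [].
by [].
Qed.

Lemma cylinder_fset1U v (F : {fset V}) (B : V -> set T) :
  cylinder (v |` F)%fset B = [set y | B v (y v)] `&` cylinder F B.
Proof.
apply/seteqP; split => [y yF|y [yv yF] w].
  by split=> [|w wF]; apply: yF; rewrite !inE ?eqxx// wF orbT.
by rewrite !inE => /orP[/eqP ->|/yF].
Qed.

Lemma cylinder_fset0 (B : V -> set T) : cylinder fset0 B = setT.
Proof. by apply/seteqP; split => // y _ v. Qed.

Lemma measurable_cylinder F B : (forall v, measurable (B v)) ->
  measurable (cylinder F B).
Proof.
move=> mB; elim/fset1U_rect : F => [|v F _ IH].
  by rewrite cylinder_fset0.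
rewrite cylinder_fset1U; apply: measurableI => //.
by rewrite -[X in measurable X]setTI; exact: measurable_coord.
Qed.

Lemma config_measure_unique (G : set (set (config V T)))
    (m1 m2 : {measure set (config V T) -> \bar R}) :
  G `<=` measurable -> setI_closed G -> G setT ->
  (forall v B, measurable B -> <<s G >> [set y : config V T | B (y v)]) ->
  (m1 setT < +oo)%E -> (forall A, G A -> m1 A = m2 A) ->
  forall A, measurable A -> m1 A = m2 A.
Proof.
move=> Gm GI GT Ggen m1oo m12; apply: (measure_unique G (fun=> setT)) => //.
- apply/seteqP; split; apply: smallest_sub.
  + exact: smallest_sigma_algebra.
  + by move=> _ [[v B]/= mB <-]; exact: Ggen.
  + exact: smallest_sigma_algebra.
  + exact: Gm.
- by rewrite bigcup_const.
Qed.

Lemma cylinder_measure_unique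
    (m1 m2 : {measure set (config V T) -> \bar R}) :
  (m1 setT < +oo)%E ->
  (forall F B, (forall v, measurable (B v)) ->
    m1 (cylinder F B) = m2 (cylinder F B)) ->
  forall A, measurable A -> m1 A = m2 A.
Proof.
move=> m1oo m12.
apply: (@config_measure_unique
  [set A | exists F B, (forall v, measurable (B v)) /\ A = cylinder F B]) => //.
- by move=> _ [F [B [mB ->]]]; exact: measurable_cylinder.
- move=> _ _ [F [B [mB ->]]] [F' [B' [mB' ->]]].
  rewrite cylinder_setI; eexists; eexists; split; last reflexivity.
  by move=> v; apply: measurableI; case: ifP.
- by exists fset0, (fun=> setT); split => //; rewrite cylinder_fset0.
- move=> v B mB; apply: sub_sigma_algebra; exists [fset v]%fset, (fun=> B).
  split => //; apply/seteqP; split => [y yB w|y]; first by rewrite inE => /eqP ->.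
  by apply; rewrite inE.
- by move=> _ [F [B [mB ->]]]; exact: m12.
Qed.

End ConfigMeasures.

(** A spin has two values, so the events that all spins of a finite set equal one fixed [c] already
    form a generating pi-system. With [c] the boundary spin, these are events that decrease as the
    window grows. *)
Lemma spin_measure_unique {R : realType} {V : countType} (c : bool)
    (m1 m2 : {measure set (config V bool) -> \bar R}) :
  (m1 setT < +oo)%E ->
  (forall F : {fset V}, m1 (cylinder F (fun=> [set c])) =
                        m2 (cylinder F (fun=> [set c]))) ->
  forall A, measurable A -> m1 A = m2 A.
Proof.
move=> m1oo m12.
pose G := [set A : set (config V bool) |
  exists F : {fset V}, A = cylinder F (fun=> [set c])].
apply: (@config_measure_unique _ _ _ _ G) => //.
- by move=> _ [F ->]; exact: measurable_cylinder.
- move=> _ _ [F ->] [F' ->]; exists (F `|` F')%fset; apply/seteqP; split.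
    by move=> y [yF yF'] v; rewrite inE => /orP[/yF|/yF'].
  by move=> y y'; split=> v vF; apply: y'; rewrite inE vF ?orbT.
- by exists fset0; rewrite cylinder_fset0.
- move=> v B _.
  have Gv : G [set y | y v = c].
    exists [fset v]%fset; apply/seteqP; split => [y /= yv w|y].
      by rewrite inE => /eqP ->.
    by apply; rewrite inE.
  pose GT : measurableType G.-sigma := g_sigma_algebraType G.
  have mv : measurable ([set y | y v = c] : set GT) by exact: sub_sigma_algebra.
  have -> : [set y : config V bool | B (y v)] =
      (if c \in B then [set y | y v = c] else set0) `|`
      (if ~~ c \in B then ~` [set y | y v = c] else set0).
    apply/seteqP; split => y /=.
      case: (eqVneq (y v) c) => [yvc Byv|yvc].
        by left; rewrite mem_set -?yvc.
      have -> : ~~ c = y v by move: yvc; case: (y v); case: (c).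
      by move=> Byv; right; rewrite mem_set//; apply/eqP.
    case=> []; case: ifPn => // /set_mem Bc; first by move=> /= ->.
    move=> /eqP yvc; suff -> : y v = ~~ c by [].
    by move: yvc; case: (y v); case: (c).
  suff : measurable ((if c \in B then [set y | y v = c] else set0) `|`
      (if ~~ c \in B then ~` [set y | y v = c] else set0) : set GT) by [].
  by apply: measurableU; case: ifP => // _; exact: measurableC.
- by move=> _ [F ->].
Qed.

(** * Independent uniform variables from binary digits *)

Lemma probability_setI_full d (T : measurableType d) (R : realType)
    (P : probability T R) (N A : set T) :
  measurable N -> measurable A -> P N = 1%E -> P (A `&` N) = P A.
Proof.
move=> mN mA PN; have mNc := measurableC mN.
rewrite -[in RHS](setIT A) -(setUv N) setIUr measureU0//.
- exact: measurableI.
- exact: measurableI.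
apply/eqP; rewrite -measure_le0 (@le_trans _ _ (P (~` N)))//.
  by apply: le_measure; rewrite ?inE//; exact: measurableI.
by rewrite probability_setC// PN subee.
Qed.

Section Laws.
Context {R : realType} d d' {T : measurableType d} {T' : measurableType d'}.

Definition law (P : probability T R) (f : T -> T')
    (mf : measurable_fun setT f) : probability T' R :=
  distribution P (mfun_Sub (mem_set mf)).

Lemma lawE P f mf A : @law P f mf A = P (f @^-1` A).
Proof. by []. Qed.

End Laws.

Lemma measurable_preimage d d' (T : measurableType d) (T' : measurableType d')
    (f : T -> T') (A : set T') :
  measurable_fun setT f -> measurable A -> measurable (f @^-1` A).
Proof. by move=> mf mA; rewrite -[X in measurable X]setTI; exact: mf. Qed.

Lemma measurable_config d d' (T : measurableType d) (T' : measurableType d')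
    (V : countType) (f : T -> config V T') :
  (forall v, measurable_fun setT (fun x => f x v)) -> measurable_fun setT f.
Proof.
move=> mf; apply: (@measurability _ _ T (config V T') setT f
  (@coordinate_events V d' T')) => //.
move=> _ [_ [[v B]/= mB <-] <-]; rewrite setTI.
exact: (measurable_preimage (mf v)).
Qed.

Section Digits.
Context {R : realType}.
Implicit Types (x : R) (n k m : nat) (B : nat -> set bool).

Definition unif : probability (measurableTypeR R) R := uniform_prob (@ltr01 R).

(** The interval [dyadic 0 0] is [[0, 1[], which carries the whole mass of [unif]; digits matter
    only there. *)
Definition dyadic n k : set R := `[k%:R / 2 ^+ n, k.+1%:R / 2 ^+ n[%classic.

Definition digit n x : bool := odd (Num.truncn (x * 2 ^+ n.+1)).

Lemma exp2_gt0 n : (0 : R) < 2 ^+ n.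
Proof. by rewrite exprn_gt0. Qed.

Lemma dyadicE n k x : dyadic n k x = (k%:R <= x * 2 ^+ n < k.+1%:R) :> Prop.
Proof. by rewrite /dyadic /= in_itv/= ler_pdivrMr ?ltr_pdivlMr ?exp2_gt0. Qed.

Lemma measurable_dyadic n k : measurable (dyadic n k : set (measurableTypeR R)).
Proof. exact: measurable_itv. Qed.

Lemma digit_dyadic n k x : dyadic n.+1 k x -> digit n x = odd k.
Proof. by rewrite dyadicE /digit => /truncn_def ->. Qed.

Lemma measurable_digit n :
  measurable_fun setT (digit n : measurableTypeR R -> bool).
Proof.
apply: (measurable_fun_bool true).
suff -> : setT `&` digit n @^-1` [set true] =
    \bigcup_(k in [set k | odd k]) dyadic n.+1 k.
  by apply: bigcup_measurable => k _; exact: measurable_dyadic.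
rewrite setTI; apply/seteqP; split => x; last first.
  by move=> [k /= ok /digit_dyadic ->].
move=> /= dx; exists (Num.truncn (x * 2 ^+ n.+1)) => //.
(* On negative numbers [truncn] is 0, hence even, so no digit 1 can arise there. *)
rewrite dyadicE truncn_itv//; apply/negPn/negP => x0; move: dx.
by rewrite /digit truncn_floor (negbTE x0).
Qed.

Lemma unifE (A : set (measurableTypeR R)) : measurable A -> A `<=` `[0, 1]%classic ->
  unif A = lebesgue_measure A.
Proof.
move=> mA A01; rewrite /unif /= /uniform_prob.
rewrite (eq_integral (fun=> 1%E)) ?integral_cst ?mul1e//.
move=> x /set_mem /A01 /=; rewrite in_itv/= /uniform_pdf => ->.
by rewrite subr0 invr1.
Qed.

Lemma unif_dyadic n k : (k < 2 ^ n)%N -> unif (dyadic n k) = (2 ^- n)%:E.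
Proof.
move=> kn; rewrite unifE//.
- rewrite /dyadic lebesgue_measure_itv/= lte_fin ltr_pM2r ?invr_gt0 ?exp2_gt0//.
  by rewrite ltr_nat ltnSn -EFinB -mulrBl -natrB// subSnn mul1r.
- exact: measurable_dyadic.
- move=> x; rewrite dyadicE /= in_itv/= => /andP[h1 h2]; apply/andP; split.
    by rewrite -(pmulr_lge0 _ (exp2_gt0 n)) (le_trans _ h1).
  rewrite -(ler_pM2r (exp2_gt0 n)) mul1r (le_trans (ltW h2))//.
  by rewrite -natrX ler_nat.
Qed.

Lemma unif_dyadic01 : unif (dyadic 0 0) = 1%E.
Proof. by rewrite unif_dyadic// expr0 invr1. Qed.

Lemma dyadic_split n k :
  dyadic n k = dyadic n.+1 k.*2 `|` dyadic n.+1 k.*2.+1.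
Proof.
have e2 x : x * 2 ^+ n.+1 = x * 2 ^+ n * 2 by rewrite exprSr mulrA.
have a0 j : (j.*2%:R : R) = j%:R * 2 by rewrite -muln2 natrM.
apply/seteqP; split => x.
  rewrite dyadicE => /andP[h1 h2].
  have [h|h] := ltP (x * 2 ^+ n.+1) k.*2.+1%:R; [left|right]; rewrite dyadicE.
    by rewrite h andbT e2 a0 ler_pM2r.
  by rewrite h/= -doubleS e2 a0 ltr_pM2r.
case; rewrite !dyadicE => /andP[].
  rewrite e2 a0 ler_pM2r// => -> h /=; rewrite -(@ltr_pM2r _ 2)// -a0.
  by rewrite (lt_trans h)// ltr_nat doubleS.
rewrite -doubleS e2 a0 [in X in _ -> X -> _]ltr_pM2r// => h ->.
rewrite andbT -(@ler_pM2r _ 2)// -a0 (le_trans _ h)//.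
by rewrite ler_nat.
Qed.

Definition fair (B : set bool) : R := (\1_B true + \1_B false) / 2.

Lemma fairT : fair setT = 1.
Proof. by rewrite /fair !indicE !in_setT -[1 + 1]/(2%:R) divff// pnatr_eq0. Qed.

Definition digits_in n m B : set R :=
  [set x | forall i, (n <= i < n + m)%N -> B i (digit i x)].

Lemma measurable_digits_in n m B :
  measurable (digits_in n m B : set (measurableTypeR R)).
Proof.
rewrite /digits_in (_ : mkset _ =
    \bigcap_(i in [set i | (n <= i < n + m)%N]) (digit i @^-1` (B i)))//.
by apply: bigcap_measurableType => i _; exact: (measurable_preimage (measurable_digit i)).
Qed.

(** Halving a dyadic interval fixes digit [n], and each half is again dyadic, of the next level;
    hence the induction over all intervals at once. *)
Lemma dyadic_digits n m k B : (k < 2 ^ n)%N ->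
  unif (dyadic n k `&` digits_in n m B) =
  (2 ^- n * \prod_(n <= i < n + m) fair (B i))%:E.
Proof.
elim: m n k => [|m IH] n k kn.
  rewrite (_ : digits_in _ _ _ = setT); last first.
    apply/seteqP; split => // x _ i; rewrite addn0 => /andP[/leq_ltn_trans h/h].
    by rewrite ltnn.
  by rewrite setIT unif_dyadic// addn0 big_geq// mulr1.
have step (c : bool) : unif (dyadic n.+1 (c + k.*2) `&` digits_in n m.+1 B) =
    (\1_(B n) c * (2 ^- n.+1 * \prod_(n.+1 <= i < n.+1 + m) fair (B i)))%:E.
  have dc x : dyadic n.+1 (c + k.*2) x -> digit n x = c.
    by move=> /digit_dyadic ->; rewrite oddD odd_double addbF oddb.
  rewrite indicE; case: (boolP (c \in B n)) => [/set_mem|/negP] Bc.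
    rewrite mul1r -(IH _ (c + k.*2)%N); last first.
      rewrite expnS mul2n -(ltn_double k) in kn *.
      by case: c {dc Bc} => //=; rewrite add1n -doubleS leq_double -ltn_double.
    congr (unif _); apply/seteqP; split => x [xc xB]; split => // i /andP[ni im].
      by apply: xB; rewrite (ltnW ni)/= -addSnnS.
    move: ni; rewrite leq_eqVlt => /predU1P[<-|ni]; first by rewrite dc.
    by apply: xB; rewrite ni addSnnS.
  rewrite mul0r (_ : _ `&` _ = set0) ?measure0//; apply/seteqP; split => // x [xc xB].
  apply: Bc; apply/mem_set; rewrite -(dc x xc); apply: xB.
  by rewrite leqnn/= addnS ltnS leq_addr.
rewrite dyadic_split setIUl measureU//; last 3 first.
- by apply: measurableI; [exact: measurable_dyadic|exact: measurable_digits_in].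
- by apply: measurableI; [exact: measurable_dyadic|exact: measurable_digits_in].
- apply/seteqP; split => // x [[/digit_dyadic d1 _] [/digit_dyadic d2 _]].
  by move: d2; rewrite d1 /= odd_double.
rewrite [X in (X + _)%E](step false) [X in (_ + X)%E](step true) -EFinD.
rewrite -mulrDl addnS -addSn [in RHS]big_ltn; last by rewrite ltnS leq_addr.
congr (_%:E); rewrite exprS invfM /fair [\1_(B n) true + _]addrC.
by rewrite !mulrA; congr (_ * _); rewrite [LHS]mulrC mulrA.
Qed.

Lemma unif_digits (F : {fset nat}) B :
  unif [set x | forall i, i \in F -> B i (digit i x)] =
  (\prod_(i <- F) fair (B i))%:E.
Proof.
pose m := (\max_(i <- F) i.+1)%N.
have Fm i : i \in F -> (i < m)%N by move=> iF; rewrite /m (big_rem i)//= leq_maxl.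
pose B' i := if i \in F then B i else setT.
have -> : [set x | forall i, i \in F -> B i (digit i x)] = digits_in 0 m B'.
  apply/seteqP; split => x h i.
    by move=> _; rewrite /B'; case: ifP => // /h.
  by move=> iF; have := h i; rewrite /B' iF; apply; rewrite Fm.
rewrite -(probability_setI_full (measurable_dyadic 0 0)) ?unif_dyadic01//; last first.
  exact: measurable_digits_in.
rewrite setIC dyadic_digits// expr0 invr1 mul1r; congr EFin.
rewrite add0n (eq_bigr (fun i => if i \in F then fair (B i) else 1)); last first.
  by move=> i _; rewrite /B'; case: ifP => // _; exact: fairT.
rewrite -big_mkcond -big_filter; apply: perm_big; apply: uniq_perm.
- by rewrite filter_uniq// iota_uniq.
- exact: fset_uniq.
- move=> i; rewrite mem_filter mem_index_iota /=.
  by apply/andP/idP => [[]//|iF]; rewrite Fm.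
Qed.

End Digits.

Lemma big_fsetU_disjoint (S : Type) (idx : S) (op : Monoid.com_law idx)
    (I : choiceType) (A B : {fset I}) (f : I -> S) :
  (forall i, i \in A -> i \notin B) ->
  \big[op/idx]_(i <- (A `|` B)%fset) f i =
  op (\big[op/idx]_(i <- A) f i) (\big[op/idx]_(i <- B) f i).
Proof.
move=> AB; rewrite -big_cat; apply: perm_big; apply: uniq_perm.
- exact: fset_uniq.
- rewrite cat_uniq !fset_uniq andbT /=; apply/hasPn => i iB.
  by apply/negP => /AB; rewrite iB.
- by move=> i; rewrite mem_cat inE.
Qed.

Section Independence.
Context {R : realType} {V : countType} d {T : measurableType d}.
Context d' {X : measurableType d'}.

(** For fixed [D] both sides are finite measures in [A], so agreement on cylinders is enough. *)
Lemma cylinder_indep (P : probability X R) (f : X -> config V T) (D : set X)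
    (Q : probability (config V T) R) :
  measurable_fun setT f -> measurable D ->
  (forall F B, (forall v, measurable (B v)) ->
    P (f @^-1` cylinder F B `&` D) = (Q (cylinder F B) * P D)%E) ->
  forall A, measurable A -> P (f @^-1` A `&` D) = (Q A * P D)%E.
Proof.
move=> mf mD PQ.
have PD0 : 0 <= fine (P D) by rewrite fine_ge0.
have [m1 m1E] : exists m1 : {measure set (config V T) -> \bar R},
    forall A, m1 A = P (f @^-1` A `&` D).
  by unshelve eexists (pushforward (mrestr P mD) (mfun_Sub (mem_set mf))).
have [m2 m2E] : exists m2 : {measure set (config V T) -> \bar R},
    forall A, m2 A = (Q A * P D)%E.
  exists (mscale (NngNum PD0) Q) => A.
  transitivity ((fine (P D))%:E * Q A)%E => //.
  by rewrite fineK ?fin_num_measure// muleC.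
move=> A mA; rewrite -m1E -m2E; apply: cylinder_measure_unique => //.
- rewrite m1E preimage_setT setTI (le_lt_trans (probability_le1 _ _))//.
  exact: ltry.
- by move=> F B mB; rewrite m1E m2E; exact: PQ.
Qed.

End Independence.

Section DigitBlocks.
Context {R : realType}.
Local Notation unif := (@unif R).
Local Notation RR := (measurableTypeR R).
Implicit Types x : R.

Definition block (i_ : nat -> nat) (x : RR) : config nat bool :=
  fun k => digit (i_ k) x.

Lemma measurable_block i_ : measurable_fun setT (block i_).
Proof. by apply: measurable_config => k; exact: measurable_digit. Qed.

Definition coins : probability (config nat bool) R := law unif (measurable_block id).

Definition digits_at (G : {fset nat}) (B : nat -> set bool) : set RR :=
  [set x | forall i, i \in G -> B i (digit i x)].

Lemma measurable_digits_at G B : measurable (digits_at G B).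
Proof. exact: (measurable_preimage (measurable_block id) (measurable_cylinder G _)). Qed.

Lemma coins_cylinder G B : coins (cylinder G B) = (\prod_(i <- G) fair (B i))%:E.
Proof. exact: unif_digits. Qed.

(** The conditions on the digits in [G] are there for the induction: when a block is peeled off,
    [cylinder_indep] reduces its event to a cylinder, that is, to finitely many further digit
    conditions, which are absorbed into [G]. Injectivity of the indexing keeps them disjoint from
    the remaining blocks. *)
Lemma block_indep (I : choiceType) (i_ : I -> nat -> nat)
    (C : I -> set (config nat bool)) (F : seq I) (G : {fset nat}) B :
  (forall a b k l, i_ a k = i_ b l -> a = b /\ k = l) ->
  (forall a, measurable (C a)) -> uniq F ->
  (forall a k, a \in F -> i_ a k \notin G) ->
  unif (digits_at G B `&` [set x | forall a, a \in F -> C a (block (i_ a) x)]) =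
  (unif (digits_at G B) * \prod_(a <- F) coins (C a))%E.
Proof.
move=> inj mC; elim: F => [|a F IH] in G B *.
  move=> _ _; rewrite big_nil mule1; congr (unif _).
  by apply/seteqP; split => [x []//|x ?]; split.
move=> /= /andP[aF uF] dis.
pose rest := digits_at G B `&` [set x | forall b, b \in F -> C b (block (i_ b) x)].
have mF (E : seq I) :
    measurable ([set x | forall b, b \in E -> C b (block (i_ b) x)] : set RR).
  elim: E => [|b E IHE].
    by rewrite (_ : mkset _ = setT)//; apply/seteqP; split.
  rewrite (_ : mkset _ = block (i_ b) @^-1` (C b) `&`
    [set x | forall b, b \in E -> C b (block (i_ b) x)]).
    apply: measurableI => //.
    exact: (measurable_preimage (@measurable_block _)).
  apply/seteqP; split => [x xE|x [xb xE] c].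
    by split=> [|c cE]; apply: xE; rewrite inE ?eqxx// cE orbT.
  by rewrite inE => /orP[/eqP ->//|]; exact: xE.
have mrest : measurable rest.
  by apply: measurableI => //; exact: measurable_digits_at.
have -> : digits_at G B `&`
    [set x | forall b, b \in a :: F -> C b (block (i_ b) x)] =
    block (i_ a) @^-1` (C a) `&` rest.
  apply/seteqP; split => [x [xG xF]|x [xa [xG xF]]].
    split; first by apply: xF; rewrite mem_head.
    by split => // b bF; apply: xF; rewrite inE bF orbT.
  by split => // b; rewrite inE => /orP[/eqP ->//|]; exact: xF.
have disF b k : b \in F -> i_ b k \notin G.
  by move=> bF; apply: dis; rewrite inE bF orbT.
rewrite (@cylinder_indep _ _ _ _ _ _ unif _ rest coins)//.
- by rewrite /rest IH// big_cons muleCA.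
- exact: measurable_block.
move=> H E mE.
have iinj : injective (i_ a) by move=> k l /inj[].
pose H' := [fset i_ a k | k in H]%fset.
(* Merges the conditions on [G] with those on the digits used by block [a]; by disjointness each
   digit carries conditions of one kind only. *)
pose E' j := [set c | (j \in G -> B j c) /\ (forall k, k \in H -> i_ a k = j -> E k c)].
have dj j : j \in H' -> j \notin G.
  by move=> /imfsetP[k kH ->]; apply: dis; rewrite mem_head.
have E'G j : j \in G -> E' j = B j.
  move=> jG; apply/seteqP; split => [c [+ _]|c Bc]; first exact.
  split => // k kH kj; have := dj j; rewrite jG => h.
  by exfalso; have : ~~ true by apply: h; rewrite -kj; apply/imfsetP; exists k.
have E'H k : k \in H -> E' (i_ a k) = E k.
  move=> kH; apply/seteqP; split => [c [_]|c Ec]; first exact.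
  split; last by move=> l _ /iinj ->.
  have : i_ a k \in H' by apply/imfsetP; exists k.
  by move=> /dj /negP.
have eqE : digits_at (H' `|` G)%fset E' =
    block (i_ a) @^-1` cylinder H E `&` digits_at G B.
  apply/seteqP; split => [x xE|x [xH xG] j].
    split => [k kH|j jG]; [rewrite -E'H// /block|rewrite -E'G//]; apply: xE;
      rewrite inE ?jG ?orbT//.
    by apply/orP; left; apply/imfsetP; exists k.
  rewrite inE => /orP[/imfsetP[k kH ->]|jG].
    by rewrite E'H//; exact: xH.
  by rewrite E'G//; exact: xG.
rewrite /rest setIA -eqE !IH//; last first.
  move=> b k bF; rewrite inE negb_or disF// andbT; apply/negP.
  move=> /imfsetP[l lH /inj[ba _]]; by rewrite -ba bF in aF.
rewrite muleA; congr (_ * _)%E.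
rewrite coins_cylinder !unif_digits -EFinM; congr EFin.
rewrite big_fsetU_disjoint; last by move=> j; exact: dj.
congr (_ * _); last by apply: eq_big_seq => j /E'G ->.
rewrite big_imfset/=; last by move=> k l _ _; exact: iinj.
by apply: eq_big_seq => k /E'H ->.
Qed.

Definition binary_value (b : config nat bool) : R :=
  fine (\sum_(0 <= k <oo) ((b k)%:R / 2 ^+ k.+1 : R)%:E).

Lemma measurable_binary_value :
  measurable_fun setT (binary_value : config nat bool -> RR).
Proof.
pose F (b : config nat bool) : \bar R :=
  (\sum_(0 <= k <oo) ((b k)%:R / 2 ^+ k.+1 : R)%:E)%E.
rewrite (_ : binary_value = fine \o F)//.
apply: (@measurableT_comp _ _ _ _ _ _ (fine : \bar R -> RR) setT F).
  exact: fine_measurable.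
apply: (@ge0_emeasurable_sum _ _ _ _
  (fun k (b : config nat bool) => ((b k)%:R / 2 ^+ k.+1 : R)%:E) xpredT).
- by move=> k b _ _; rewrite lee_fin divr_ge0// exprn_ge0.
- move=> k _; apply/measurable_EFinP.
  have -> : (fun b : config nat bool => (b k)%:R / 2 ^+ k.+1 : R) =
      (fun c : bool => c%:R / 2 ^+ k.+1) \o (fun b : config nat bool => b k).
    by [].
  by apply: measurableT_comp => //; exact: measurable_coord.
Qed.

Lemma digit_sum x n : dyadic 0 0 x ->
  \sum_(0 <= k < n) (digit k x)%:R / 2 ^+ k.+1 =
  (Num.truncn (x * 2 ^+ n))%:R / 2 ^+ n :> R.
Proof.
rewrite dyadicE expr0 mulr1 => x01; elim: n => [|n IH].
  by rewrite big_geq// expr0 mulr1 (truncn_def x01) mul0r.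
have x0 : 0 <= x by case/andP: x01.
rewrite big_nat_recr//= IH; set k := Num.truncn _.
have kx : dyadic n k x by rewrite dyadicE truncn_itv// mulr_ge0// exprn_ge0.
have e2 : (2 ^+ n : R) != 0 by rewrite expf_neq0.
suff -> : Num.truncn (x * 2 ^+ n.+1) = (digit n x + k.*2)%N.
  rewrite natrD mulrDl addrC; congr (_ + _).
  by rewrite -muln2 natrM exprSr invfM mulrACA divff// mulr1.
rewrite dyadic_split in kx; case: kx => kx; rewrite (digit_dyadic kx);
  by move: kx; rewrite dyadicE => /truncn_def ->; rewrite /= odd_double.
Qed.

Lemma binary_value_digits x : dyadic 0 0 x -> binary_value (block id x) = x :> R.
Proof.
move=> x01; rewrite /binary_value.
suff -> : (\sum_(0 <= k <oo) ((block id x k)%:R / 2 ^+ k.+1 : R)%:E = x%:E)%E by [].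
apply/cvg_lim => //.
have -> : (fun n => \sum_(0 <= k < n) ((block id x k)%:R / 2 ^+ k.+1 : R)%:E)%E =
    EFin \o (fun n => (Num.truncn (x * 2 ^+ n))%:R / 2 ^+ n : R).
  by apply/funext => n /=; rewrite sumEFin digit_sum.
apply: cvg_EFin; first exact: nearW.
(* Truncation after [n] digits loses at most [2^-n]. *)
apply: (@squeeze_cvgr _ _ _ _ (fun n => x - 2^-1 ^+ n) (fun=> x)).
- apply: nearW => n; have /andP[h1 h2] : dyadic n (Num.truncn (x * 2 ^+ n)) x.
    rewrite dyadicE truncn_itv// mulr_ge0// ?exprn_ge0//.
    by move: x01; rewrite dyadicE expr0 mulr1 => /andP[].
  move: h1 h2; rewrite /dyadic !bnd_simp => h1 h2.
  rewrite h1 andbT lerBlDr exprVn -[X in _ + X]mul1r -mulrDl natr1.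
  exact: ltW.
- rewrite -[X in _ --> X]subr0; apply: cvgB; first exact: cvg_cst.
  by apply: cvg_expr; rewrite ger0_norm ?invr_ge0// invf_lt1 ?ltr1n.
- exact: cvg_cst.
Qed.

(** On [[0, 1[], reading the digits of [x] and summing them returns [x]. So fair coins, being the
    law of these digits, have a binary value that is uniform. *)
Lemma unif_binary_value (B : set RR) : measurable B ->
  coins (binary_value @^-1` B) = unif B.
Proof.
move=> mB; rewrite lawE.
have m1 : measurable (block id @^-1` (binary_value @^-1` B)).
  apply: (measurable_preimage (@measurable_block _)).
  exact: (measurable_preimage measurable_binary_value).
rewrite -(probability_setI_full (measurable_dyadic 0 0) m1 unif_dyadic01).
rewrite -[RHS](probability_setI_full (measurable_dyadic 0 0) mB unif_dyadic01).
congr (unif _); apply/seteqP; split => x [/= xB x01].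
  by split => //; rewrite binary_value_digits in xB.
by split => //; rewrite binary_value_digits.
Qed.

Definition uniform_block (i_ : nat -> nat) (x : RR) : RR := binary_value (block i_ x).

Lemma measurable_uniform_block i_ : measurable_fun setT (uniform_block i_).
Proof.
exact: (measurableT_comp measurable_binary_value (measurable_block i_)).
Qed.

Lemma uniform_block_indep (I : choiceType) (i_ : I -> nat -> nat) (F : seq I)
    (B : I -> set RR) :
  (forall a b k l, i_ a k = i_ b l -> a = b /\ k = l) ->
  (forall a, measurable (B a)) -> uniq F ->
  unif [set x | forall a, a \in F -> B a (uniform_block (i_ a) x)] =
  (\prod_(a <- F) unif (B a))%E.
Proof.
move=> inj mB uF.
have mC a : measurable (binary_value @^-1` (B a)).
  exact: (measurable_preimage measurable_binary_value).
have := @block_indep _ i_ _ F fset0 (fun=> setT) inj mC uF (fun _ _ _ => erefl).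
have -> : digits_at fset0 (fun=> setT) = setT by apply/seteqP; split.
rewrite setTI probability_setT mul1e => ->.
by apply: eq_bigr => a _; rewrite unif_binary_value.
Qed.

End DigitBlocks.

Section UniformField.
Context {R : realType} (V : countType).

(* Countably many independent uniform variables are read off the digits of one. *)
Definition uniform_field (x : measurableTypeR R) : config V (measurableTypeR R) :=
  fun v => uniform_block (fun k => choice.pickle (v, k)) x.

Lemma measurable_uniform_field : measurable_fun setT uniform_field.
Proof. by apply: measurable_config => v; exact: measurable_uniform_block. Qed.

Definition iid_unif : probability (config V (measurableTypeR R)) R :=
  law unif measurable_uniform_field.

Lemma iid_unif_cylinder (F : {fset V}) (B : V -> set (measurableTypeR R)) :
  (forall v, measurable (B v)) ->
  iid_unif (cylinder F B) = (\prod_(v <- F) unif (B v))%E.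
Proof.
move=> mB; rewrite lawE.
apply: (uniform_block_indep (i_ := fun v k => choice.pickle (v, k))) => // a b k l.
by move=> /(pcan_inj (@choice.pickleK (V * nat)%type))[].
Qed.

Lemma iid_law_unif : iid_law iid_unif.
Proof. by exists unif => F B; exact: iid_unif_cylinder. Qed.

End UniformField.

Lemma standard_borel_real (R : realType) : standard_borel R (measurableTypeR R).
Proof.
exists R; split.
- exact: norm_hausdorff.
- exists (range (fun q : rat * rat => ball (@ratr R q.1) (ratr q.2))).
    by apply: (card_le_trans (card_image_le _ _)); exact: countableP.
  split; first by move=> _ [q _ <-]; exact: ball_open.
  move=> x A; rewrite nbhsE => -[U [oU Ux] UA].
  have [q [r [/set_mem xB BU]]] := open_subball_rat oU (mem_set Ux).
  exists (@ball R R (ratr q) (ratr r)); last exact: subset_trans BU UA.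
  by split => //; exists (q, r).
- exists id; first by exists id.
  move=> A; rewrite preimage_id; split.
    by apply: smallest_sub; [exact: sigma_algebra_measurable|
       move=> U; exact: open_measurable].
  suff : (@RGenOpens.G R).-sigma.-measurable `<=` <<s open >>.
    by rewrite -(RGenOpens.measurableE R); exact.
  apply: smallest_sub; first exact: smallest_sigma_algebra.
  move=> _ [x [y ->]]; apply: sub_sigma_algebra; exact: itv_open.
Qed.

(** * The random order *)

Section FiniteRange.
Context {R : realType} d {X : measurableType d} (P : {measure set X -> \bar R}).

Lemma measure_fibers (S : choiceType) (f : X -> S) (r : seq S) (A : set X) :
  uniq r -> measurable A -> {in r, forall s, measurable [set x | f x = s]} ->
  P (A `&` [set x | f x \in r]) = (\sum_(s <- r) P (A `&` [set x | f x = s]))%E.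
Proof.
move=> + mA; elim: r => [_ _|s r IH /= /andP[sr ur] mf].
  rewrite big_nil (_ : [set x | _] = set0) ?setI0 ?measure0//.
  by apply/seteqP; split.
have mfr : {in r, forall s, measurable [set x | f x = s]}.
  by move=> t tr; apply: mf; rewrite inE tr orbT.
have mr : measurable [set x | f x \in r].
  have -> : [set x | f x \in r] = \big[setU/set0]_(t <- r) [set x | f x = t].
    rewrite -bigcup_seq; apply/seteqP; split => x /=; first by exists (f x).
    by move=> [t /= tr ->].
  by rewrite big_seq; apply: bigsetU_measurable.
have ms : measurable [set x | f x = s] by apply: mf; rewrite mem_head.
rewrite big_cons -IH// (_ : A `&` _ =
  (A `&` [set x | f x = s]) `|` (A `&` [set x | f x \in r])).
  rewrite measureU//; try exact: measurableI.
  by apply/seteqP; split => // x [[_ /= fs] [_ /=]]; rewrite fs (negbTE sr).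
rewrite -setIUr; congr (_ `&` _); apply/seteqP; split => x /=.
  by rewrite inE => /orP[/eqP|]; [left|right].
by rewrite inE => -[->|->]; rewrite ?eqxx ?orbT.
Qed.

Lemma measurable_finite_range (S : choiceType) (f : X -> S) (r : seq S) (C : set S) :
  (forall x, f x \in r) -> {in r, forall s, measurable [set x | f x = s]} ->
  measurable (f @^-1` C).
Proof.
move=> fr mf.
have -> : f @^-1` C = \big[setU/set0]_(s <- r | s \in C) [set x | f x = s].
  rewrite -bigcup_seq_cond; apply/seteqP; split => x /=.
    by move=> Cx; exists (f x) => //=; rewrite fr mem_set.
  by move=> [s /= /andP[_ /set_mem Cs] ->].
by rewrite big_seq_cond; apply: bigsetU_measurable => s /andP[sr _]; exact: mf.
Qed.

End FiniteRange.

Section RandomOrder.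
Context {R : realType} {V : countType}.
Local Notation RR := (measurableTypeR R).
Implicit Types (w : V -> R) (L M : {fset V}).

(* Ties are broken by the enumeration of [V], so that the order is total for
   every labelling; this breaks equivariance only on a null event. *)
Definition prec w : rel V := fun a b =>
  (w a < w b) || ((w a == w b) && (choice.pickle a <= choice.pickle b)%N).

Lemma prec_total w : total (prec w).
Proof. by move=> a b; rewrite /prec; case: ltgtP => //= _; exact: leq_total. Qed.

Lemma prec_trans w : transitive (prec w).
Proof.
move=> b a c; rewrite /prec => /orP[ab|/andP[/eqP -> ab]] /orP[bc|/andP[/eqP <- bc]].
- by rewrite (lt_trans ab bc).
- by rewrite ab.
- by rewrite bc.
- by rewrite eqxx (leq_trans ab bc) orbT.
Qed.

Lemma prec_anti w : antisymmetric (prec w).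
Proof.
move=> a b; rewrite /prec; case: ltgtP => //= _ h.
exact: (pcan_inj (@choice.pickleK V) (anti_leq h)).
Qed.

Definition arranged w L : seq V := sort (prec w) (enum_fset L).

Lemma perm_arranged w L : perm_eq (arranged w L) (enum_fset L).
Proof. by rewrite perm_sort. Qed.

Lemma mem_arranged w L : arranged w L =i L.
Proof. by move=> v; rewrite mem_sort. Qed.

Lemma uniq_arranged w L : uniq (arranged w L).
Proof. by rewrite sort_uniq fset_uniq. Qed.

Lemma arrangedP w L l : perm_eq l (enum_fset L) ->
  arranged w L = l <-> sorted (prec w) l.
Proof.
move=> lL; split => [<-|sl]; first exact/sort_sorted/prec_total.
apply: (sorted_eq (@prec_trans w) (@prec_anti w)) => //.
  exact/sort_sorted/prec_total.
by rewrite (perm_trans (perm_arranged w L))// perm_sym.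
Qed.

(** The order inside a subset does not depend on the ambient window. Any two windows are therefore
    filters of one list, the form in which [sample_le] compares them. *)
Lemma arranged_sub w L M : (L `<=` M)%fset ->
  arranged w L = [seq v <- arranged w M | v \in L].
Proof.
move=> LM; apply/arrangedP; last first.
  by rewrite sorted_filter//; [exact: prec_trans|exact/sort_sorted/prec_total].
apply: uniq_perm; rewrite ?filter_uniq ?uniq_arranged ?fset_uniq//.
move=> v; rewrite mem_filter mem_arranged andb_idr//.
exact: (fsubsetP LM).
Qed.

Lemma measurable_arranged L l : perm_eq l (enum_fset L) ->
  measurable [set w : config V RR | arranged w L = l].
Proof.
move=> lL; have -> : [set w : config V RR | arranged w L = l] =
    [set w | sorted (prec w) l].
  by apply/seteqP; split => w /=; rewrite arrangedP.
have mp a b : measurable_fun setT (fun w : config V RR => prec w a b).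
  apply: measurable_or.
    by apply: measurable_fun_ltr; exact: measurable_coord.
  apply: measurable_and; last exact: measurable_cst.
  by apply: measurable_fun_eqr; exact: measurable_coord.
have ms : measurable_fun setT (fun w : config V RR => sorted (prec w) l).
  case: l {lL} => [|a l] /=; first exact: measurable_cst.
  elim: l a => [|b l IH] a /=; first exact: measurable_cst.
  by apply: measurable_and.
exact: (@measurable_preimage _ _ _ _ _ [set true] ms).
Qed.

End RandomOrder.

(** * Independent labels and heights at each vertex *)

Section LabelsHeights.
Context {R : realType} {V : countType}.
Local Notation RR := (measurableTypeR R).
Local Notation P := (@iid_unif R V).

(* The label and the height of a vertex use the even and the odd binary digits
   of its uniform variable. *)
Definition height : RR -> RR := uniform_block (fun k => (true + k.*2)%N).
Definition label : RR -> RR := uniform_block (fun k => (false + k.*2)%N).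

Lemma unif_label_height (A B : set RR) : measurable A -> measurable B ->
  unif (label @^-1` A `&` height @^-1` B) = (unif A * unif B)%E.
Proof.
move=> mA mB.
have := @uniform_block_indep R bool (fun c k => (c + k.*2)%N) [:: true; false]
  (fun c => if c then B else A).
rewrite !big_cons big_nil mule1 muleC => <-//.
- congr (unif _); apply/seteqP; split => x /=.
    by move=> [xA xB] [].
  by move=> h; split; [exact: (h false)|exact: (h true)].
- move=> a b k l akl; have := congr1 odd akl; rewrite !oddD !odd_double !addbF !oddb.
  move=> ab; split => //; move: akl; rewrite ab => /addnI/(congr1 half).
  by rewrite !doubleK.
- by case.
Qed.

Definition labels (y : config V RR) : config V RR := fun v => label (y v).
Definition heights (y : config V RR) : config V RR := fun v => height (y v).

Lemma measurable_labels : measurable_fun setT labels.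
Proof.
apply: measurable_config => v.
exact: (measurableT_comp (@measurable_uniform_block _ _) (measurable_coord v)).
Qed.

Lemma measurable_heights : measurable_fun setT heights.
Proof.
apply: measurable_config => v.
exact: (measurableT_comp (@measurable_uniform_block _ _) (measurable_coord v)).
Qed.

Lemma big_fset_sub (S : Type) (idx : S) (op : Monoid.com_law idx)
    (I : choiceType) (A B : {fset I}) (f : I -> S) : (A `<=` B)%fset ->
  \big[op/idx]_(i <- B) (if i \in A then f i else idx) = \big[op/idx]_(i <- A) f i.
Proof.
move=> AB; rewrite -big_mkcond -big_filter; apply: perm_big; apply: uniq_perm.
- exact/filter_uniq/fset_uniq.
- exact: fset_uniq.
- by move=> i; rewrite mem_filter andb_idr//; exact: (fsubsetP AB).
Qed.

Lemma labels_heights_cylinder (F G : {fset V}) (A B : V -> set RR) :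
  (forall v, measurable (A v)) -> (forall v, measurable (B v)) ->
  P (labels @^-1` cylinder G A `&` heights @^-1` cylinder F B) =
  ((\prod_(v <- G) unif (A v)) * \prod_(v <- F) unif (B v))%E.
Proof.
move=> mA mB.
pose A' v := if v \in G then A v else setT.
pose B' v := if v \in F then B v else setT.
have mA' v : measurable (A' v) by rewrite /A'; case: ifP.
have mB' v : measurable (B' v) by rewrite /B'; case: ifP.
have -> : labels @^-1` cylinder G A `&` heights @^-1` cylinder F B =
    cylinder (G `|` F)%fset (fun v => label @^-1` A' v `&` height @^-1` B' v).
  apply/seteqP; split => [y [yG yF] v _|y h].
    by split; rewrite /A' /B' /=; case: ifP => // ?; [exact: yG|exact: yF].
  by split => v vG; have := h v; rewrite inE vG ?orbT => /(_ isT)[];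
    rewrite /A' /B' /= vG.
rewrite iid_unif_cylinder; last first.
  by move=> v; apply: measurableI; apply: (measurable_preimage (@measurable_uniform_block _ _)).
rewrite (eq_bigr (fun v => (unif (A' v) * unif (B' v))%E)); last first.
  by move=> v _; exact: unif_label_height.
rewrite big_split/=; congr (_ * _)%E.
  rewrite -(@big_fset_sub _ _ _ _ G (G `|` F)%fset) ?fsubsetUl//.
  by apply: eq_bigr => v _; rewrite /A'; case: ifP => // _; rewrite probability_setT.
rewrite -(@big_fset_sub _ _ _ _ F (G `|` F)%fset) ?fsubsetUr//.
by apply: eq_bigr => v _; rewrite /B'; case: ifP => // _; rewrite probability_setT.
Qed.

Lemma heights_cylinder (F : {fset V}) (B : V -> set RR) :
  (forall v, measurable (B v)) ->
  P (heights @^-1` cylinder F B) = (\prod_(v <- F) unif (B v))%E.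
Proof.
move=> mB; have := @labels_heights_cylinder F fset0 (fun=> setT) B (fun=> measurableT) mB.
by rewrite cylinder_fset0 preimage_setT setTI big_seq_fset0 mul1e.
Qed.

(** Conditioning on the order, which is a function of the labels, leaves the heights independent and
    uniform. *)
Lemma labels_heights_indep (A : set (config V RR)) (F : {fset V}) (B : V -> set RR) :
  measurable A -> (forall v, measurable (B v)) ->
  P (labels @^-1` A `&` heights @^-1` cylinder F B) =
  (P (labels @^-1` A) * \prod_(v <- F) unif (B v))%E.
Proof.
move=> mA mB.
have indep (D : set (config V RR)) : measurable D -> (forall G C, (forall v, measurable (C v)) ->
    P (labels @^-1` cylinder G C `&` D) = ((\prod_(v <- G) unif (C v)) * P D)%E) ->
    P (labels @^-1` A `&` D) = (P A * P D)%E.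
  move=> mD h; apply: (cylinder_indep measurable_labels) => // G C mC.
  by rewrite h// iid_unif_cylinder.
rewrite indep.
(* With [D] the whole space this says that the labels again have law [P]. *)
- have := indep setT measurableT; rewrite setIT probability_setT mule1 => ->.
    by rewrite heights_cylinder.
  move=> G C mC; have := @labels_heights_cylinder fset0 G C (fun=> setT) mC (fun=> measurableT).
  by rewrite cylinder_fset0 preimage_setT big_seq_fset0.
- by apply: (measurable_preimage measurable_heights); exact: measurable_cylinder.
- by move=> G C mC; rewrite labels_heights_cylinder// heights_cylinder.
Qed.

Lemma measurable_labels_tie (a b : V) : measurable [set y | labels y a = labels y b].
Proof.
have h : measurable_fun setT (fun y : config V RR => labels y a == labels y b).
  by apply: measurable_fun_eqr;
    apply: (measurableT_comp (@measurable_coord _ _ _ _) measurable_labels).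
have := @measurable_preimage _ _ _ _ _ [set true] h.
rewrite (_ : _ @^-1` _ = [set y | labels y a = labels y b]); first exact.
by apply/seteqP; split => y /= /eqP.
Qed.

(** A tie in [[0, 1[] puts both labels into the same one of [2^n] dyadic intervals of length [2^-n].
    By independence each interval contributes [4^-n], so a tie has probability at most [2^-n] for
    every [n]. *)
Lemma labels_tie_null (a b : V) : a != b ->
  P [set y | labels y a = labels y b] = 0%E.
Proof.
move=> ab; have mab := measurable_labels_tie a b.
pose D := [set y | dyadic 0 0 (labels y a)].
have mD : measurable D.
  apply: (measurable_preimage _ (measurable_dyadic 0 0)).
  exact: (measurableT_comp (@measurable_coord _ _ _ _) measurable_labels).
have cylE F (A : V -> set RR) : (forall v, measurable (A v)) ->
    P (labels @^-1` cylinder F A) = (\prod_(v <- F) unif (A v))%E.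
  move=> mA; have := @labels_heights_cylinder fset0 F A (fun=> setT) mA (fun=> measurableT).
  by rewrite cylinder_fset0 preimage_setT setIT big_seq_fset0 mule1.
have PD : P D = 1%E.
  have := cylE [fset a]%fset (fun=> dyadic 0 0) (fun=> measurable_dyadic 0 0).
  rewrite big_seq_fset1 unif_dyadic01 => <-; congr (P _).
  apply/seteqP; split => y /=; first by move=> h v; rewrite inE => /eqP ->.
  by apply; rewrite inE.
have PE := probability_setI_full mD mab PD.
have bound n : (P [set y | labels y a = labels y b] <= (2^-1 ^+ n)%:E)%E.
  pose A (k : nat) := labels @^-1` cylinder [fset a; b]%fset (fun=> dyadic n k).
  have mA k : measurable (A k).
    apply: (measurable_preimage measurable_labels).
    by apply: measurable_cylinder => v; exact: measurable_dyadic.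
  have sub : [set y | labels y a = labels y b] `&` D `<=`
      \big[setU/set0]_(k < 2 ^ n) A k.
    move=> y [/= yab]; rewrite /D /= dyadicE expr0 mulr1 => /andP[y0 y1].
    rewrite -bigcup_mkord; exists (Num.truncn (labels y a * 2 ^+ n)).
      rewrite /= truncn_lt_nat ?mulr_ge0 ?exprn_ge0// natrX.
      by rewrite -[ltRHS]mul1r ltr_pM2r ?exp2_gt0.
    move=> v; rewrite !inE => /orP[]/eqP ->; rewrite -?yab dyadicE truncn_itv//;
      by rewrite mulr_ge0// exprn_ge0.
  rewrite -PE; apply: (@le_trans _ _ (P (\big[setU/set0]_(k < 2 ^ n) A k))).
    apply: le_measure; rewrite ?inE//; first exact: measurableI.
    by apply: bigsetU_measurable.
  apply: le_trans (Boole_inequality _ _) _ => //.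
  rewrite (eq_bigr (fun=> (2 ^- n * 2 ^- n)%:E)); last first.
    move=> k _; apply: etrans (cylE _ _ (fun=> measurable_dyadic n k)) _.
    by rewrite big_fsetU1 ?inE//= big_seq_fset1 !unif_dyadic//.
  rewrite sumEFin lee_fin sumr_const card_ord -[leLHS]mulr_natl natrX mulrA.
  by rewrite divff ?mul1r ?exprVn// expf_neq0.
apply/eqP; rewrite -measure_le0; apply/lee_addgt0Pr => eps e0; rewrite add0e.
have [n hn] : exists n, (2^-1 : R) ^+ n < eps.
  have h : `|2^-1 : R| < 1 by rewrite ger0_norm ?invr_ge0// invf_lt1 ?ltr1n.
  have /cvgrPdist_lt/(_ _ e0)[n _ /(_ n (leqnn n))] := cvg_expr h.
  rewrite /= sub0r normrN ger0_norm ?exprn_ge0 ?invr_ge0// => hn.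
  by exists n.
by rewrite (le_trans (bound n))// lee_fin ltW.
Qed.

End LabelsHeights.

(** * The field in a finite window *)

Section UnifThreshold.
Context {R : realType}.
Local Notation RR := (measurableTypeR R).

Lemma unif_lt (p : R) : 0 <= p <= 1 -> unif ([set x | x < p] : set RR) = p%:E.
Proof.
move=> /andP[p0 p1].
have mp : measurable ([set x | x < p] : set RR).
  by rewrite -(set_itv_infty_o p); exact: measurable_itv.
rewrite /unif /= /uniform_prob integral_uniform_pdf.
have -> : [set x | x < p] `&` `[0, 1]%classic = `[0, p[%classic.
  apply/seteqP; split => x /=; rewrite !in_itv/=.
    by move=> [-> /andP[->]].
  by move=> /andP[-> xp]; rewrite xp (le_trans (ltW xp) p1).
rewrite (eq_integral (fun=> 1%E)); last first.
  move=> x /set_mem /=; rewrite in_itv/= /uniform_pdf => /andP[-> xp].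
  by rewrite (le_trans (ltW xp) p1) subr0 invr1.
rewrite integral_cst//= mul1e lebesgue_measure_itv/= lte_fin.
by case: ltgtP p0 => //= [_ _|<- _]; rewrite ?sube0 ?oppr0 ?adde0.
Qed.

Lemma measurable_threshold (p : R) b : measurable ([set x | (x < p) = b] : set RR).
Proof.
have mp : measurable ([set x | x < p] : set RR).
  by rewrite -(set_itv_infty_o p); exact: measurable_itv.
case: b => //; rewrite (_ : mkset _ = ~` [set x | x < p]); first exact: measurableC.
by apply/seteqP; split => x /= /negP; rewrite ?negbK; case: (x < p).
Qed.

Lemma unif_threshold (p : R) b : 0 <= p <= 1 ->
  unif ([set x | (x < p) = b] : set RR) = (if b then p else 1 - p)%:E.
Proof.
move=> p01; case: b; first exact: unif_lt.
rewrite (_ : mkset _ = ~` [set x | x < p]).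
  rewrite probability_setC ?unif_lt ?EFinB//.
  exact: (measurable_threshold p true).
by apply/seteqP; split => x /= /negP; rewrite ?negbK; case: (x < p).
Qed.

End UnifThreshold.

Section Field.
Context {R : realType} {V : countType}.
Local Notation RR := (measurableTypeR R).
Local Notation P := (@iid_unif R V).
Variable J : {fset V} -> R.
Hypothesis J_ge0 : forall A : {fset V}, (#|` A| <= 2)%N -> 0 <= J A.
Hypothesis J_summable : forall v : V,
  (\esum_(A in [set A : {fset V} | v \in A /\ (#|` A| <= 2)%N]) (J A)%:E
    < +oo)%E.
Implicit Types (L M : {fset V}) (y : config V RR) (c : bool) (l : seq V).

Let W := window_weight J.
Let W_gt0 k s : 0 < W k s := window_weight_gt0 J k s.
Let W_factor : window_factor W := window_weight_factor J_ge0 J_summable.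

Definition reveal l c y : config V bool :=
  sample (site_prob (window_weight J)) l (fun=> c) (heights y).

Definition field L c y : config V bool := reveal (arranged (labels y) L) c y.

Let B l (s : V -> bool) v : set RR := [set x | (x < threshold (site_prob W) l s v) = s v].

Let mB l s v : measurable (B l s v).
Proof. exact: measurable_threshold. Qed.

Lemma reveal_fiber l c s : uniq l -> s \in fillings l (fun=> c) ->
  [set y | reveal l c y = s] = heights @^-1` cylinder [fset x in l]%fset (B l s).
Proof.
move=> ul /(mem_fillings _ _ ul) sl; apply/seteqP; split => y /=.
  move=> /(@sampleP _ _ W _ _ _ _ ul)[_ h] v; rewrite inE; exact: h.
move=> h; apply/(@sampleP _ _ W _ _ _ _ ul); split => // v vl.
by apply: h; rewrite inE.
Qed.

Lemma reveal_fillings l c y : uniq l -> reveal l c y \in fillings l (fun=> c).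
Proof. by move=> ul; apply/(mem_fillings _ _ ul); exact: sample_off. Qed.

Lemma measurable_reveal_fiber l c s : uniq l -> s \in fillings l (fun=> c) ->
  measurable [set y | reveal l c y = s].
Proof.
move=> ul sl; rewrite reveal_fiber//.
by apply: (measurable_preimage measurable_heights); exact: measurable_cylinder.
Qed.

Lemma measurable_reveal l c C : uniq l -> measurable (reveal l c @^-1` C).
Proof.
move=> ul; apply: (measurable_finite_range (r := fillings l (fun=> c))).
  by move=> y; exact: reveal_fillings.
by move=> s; exact: measurable_reveal_fiber.
Qed.

(** The label event [A] is carried along so that it can later be the event that the random order
    equals [l]. Each fiber of [reveal] is a product event for the heights, and its probability
    telescopes to the normalised Ising weight. *)
Lemma reveal_law l c (A : set (config V RR)) C : uniq l -> measurable A ->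
  P (labels @^-1` A `&` reveal l c @^-1` C) =
  (P (labels @^-1` A) * ising_measure J [fset x in l]%fset (fun=> c) C)%E.
Proof.
move=> ul mA; rewrite ising_measureE//.
have mlA : measurable (labels @^-1` A).
  exact: (measurable_preimage measurable_labels).
have -> : labels @^-1` A `&` reveal l c @^-1` C =
    (labels @^-1` A `&` reveal l c @^-1` C) `&`
    [set y | reveal l c y \in fillings l (fun=> c)].
  apply/seteqP; split => [y h|y []//]; split => //=; exact: reveal_fillings.
rewrite measure_fibers; last 3 first.
- exact: uniq_fillings.
- by apply: measurableI => //; exact: measurable_reveal.
- by move=> s; exact: measurable_reveal_fiber.
rewrite ge0_sume_distrr; last first.
  by move=> s _; rewrite lee_fin divr_ge0// ltW// pfun_gt0.
rewrite [RHS]big_mkcond; apply: eq_big_seq => s sl.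
rewrite -setIA; case: ifPn => sC; last first.
  rewrite (_ : _ `&` (_ `&` _) = set0) ?measure0//.
  apply/seteqP; split => // y [_ [/= yC ys]]; move/negP: sC; apply.
  by rewrite -ys mem_set.
rewrite (_ : reveal l c @^-1` C `&` _ = [set y | reveal l c y = s]); last first.
  apply/seteqP; split => [y []//|y /= ys]; split => //=.
  by rewrite ys; exact: set_mem.
rewrite reveal_fiber//; apply: etrans (labels_heights_indep _ mA (mB l s)) _.
congr (_ * _)%E.
rewrite (eq_bigr (fun v => (if s v then threshold (site_prob W) l s v
    else 1 - threshold (site_prob W) l s v)%:E)); last first.
  by move=> v _; rewrite unif_threshold//; exact: threshold_itv.
rewrite prodEFin (perm_big l); last first.
  apply: uniq_perm => //; first exact: fset_uniq.
  by move=> v; rewrite inE.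
rewrite (threshold_prod W_gt0 W_factor ul (k := l) (t := fun=> c))//.
by apply/(mem_fillings _ _ ul).
Qed.

Let marr L l : l \in permutations (enum_fset L) ->
  measurable (labels @^-1` [set w : config V RR | arranged w L = l]).
Proof.
rewrite mem_permutations => lL.
by apply: (measurable_preimage measurable_labels); exact: measurable_arranged.
Qed.

Let arr_perm L y : arranged (labels y) L \in permutations (enum_fset L).
Proof. by rewrite mem_permutations perm_arranged. Qed.

Lemma field_arranged L c C l :
  field L c @^-1` C `&` [set y | arranged (labels y) L = l] =
  labels @^-1` [set w : config V RR | arranged w L = l] `&` reveal l c @^-1` C.
Proof.
by apply/seteqP; split => y /= []; rewrite /field => h1 h2;
  split; rewrite -?h1 -?h2 // ?h1 ?h2.
Qed.

Lemma measurable_field L c C : measurable (field L c @^-1` C).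
Proof.
have -> : field L c @^-1` C = \big[setU/set0]_(l <- permutations (enum_fset L))
    (labels @^-1` [set w : config V RR | arranged w L = l] `&` reveal l c @^-1` C).
  rewrite -bigcup_seq; apply/seteqP; split => y.
    move=> yC; exists (arranged (labels y) L); first exact: arr_perm.
    by rewrite -field_arranged.
  by move=> [l _ []/= al rl]; rewrite /field al.
rewrite big_seq; apply: bigsetU_measurable => l lL.
apply: measurableI; first exact: marr.
apply: measurable_reveal; rewrite mem_permutations in lL.
by rewrite (perm_uniq lL) fset_uniq.
Qed.

(** Whatever the order, revealing the window produces the same Ising measure, so summing over the
    finitely many orders only collects the total mass of the labels. *)
Lemma field_law L c C : P (field L c @^-1` C) = ising_measure J L (fun=> c) C.
Proof.
pose r := permutations (enum_fset L).
have fibers (A : set (config V RR)) : measurable A -> P A =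
    (\sum_(l <- r) P (A `&` [set y | arranged (labels y) L = l]))%E.
  move=> mA; rewrite -(measure_fibers _ (permutations_uniq _) mA)//; last first.
    by move=> l; exact: marr.
  by congr (P _); apply/seteqP; split => [y Ay|y []//]; split => //; exact: arr_perm.
rewrite (fibers _ (measurable_field L c C)).
rewrite (eq_big_seq (fun l => P (labels @^-1` [set w : config V RR | arranged w L = l]) *
    ising_measure J L (fun=> c) C)%E); last first.
  move=> l; rewrite /r mem_permutations => lL; rewrite field_arranged.
  have ul : uniq l by rewrite (perm_uniq lL) fset_uniq.
  have lE : [fset x in l]%fset = L.
    by apply/fsetP => v; rewrite inE (perm_mem lL).
  by apply: etrans (reveal_law _ _ ul (measurable_arranged lL)) _; rewrite lE.
rewrite -ge0_sume_distrl//; have := fibers setT measurableT.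
rewrite probability_setT (eq_bigr (fun l =>
  P (labels @^-1` [set w : config V RR | arranged w L = l]))) => [<-|l _]; first by rewrite mul1e.
by rewrite setTI.
Qed.

Let W_sm k : log_supermodular (W k).
Proof. exact: window_weight_supermodular. Qed.

(** Two arbitrary windows are compared inside their union: a site outside [L] stays at - below, a
    site outside [M] stays at + above. *)
Lemma field_false_le_true L M y v : field L false y v ==> field M true y v.
Proof.
rewrite /field /reveal (arranged_sub _ (fsubsetUl L M)) (arranged_sub _ (fsubsetUr L M)).
apply: (sample_le W_gt0 W_factor) => //.
- exact: uniq_arranged.
- by move=> w _; rewrite orbT.
- by move=> w _; rewrite orbT.
Qed.

(** In the larger window the sites of [M] outside [L] are sampled instead of being frozen at the
    extreme value [c], which by monotonicity can only move spins away from [c]. *)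
Lemma field_shrink L M c y v : (L `<=` M)%fset ->
  field M c y v = c -> field L c y v = c.
Proof.
move=> LM; have MM w : w \in arranged (labels y) M -> w \in M by rewrite mem_arranged.
(* The list of [M] is written as a trivial filter of itself to match [sample_le]. *)
rewrite /field /reveal (arranged_sub _ LM) [in X in X -> _](arranged_sub _ (fsubset_refl M)).
case: c => h.
  move: h; apply/implyP; apply: (sample_le W_gt0 W_factor) => //.
    exact: uniq_arranged.
    by move=> w /MM ->.
  by move=> w _; rewrite orbT.
apply/negP => h'; move/negP: h; apply; move: h'; apply/implyP.
apply: (sample_le W_gt0 W_factor) => //; first exact: uniq_arranged.
  by move=> w _; rewrite orbT.
by move=> w /MM ->.
Qed.

End Field.

(** * The infinite-volume limit *)

Section Exhaustion.
Context {V : countType}.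

Definition exhaustion (n : nat) : {fset V} :=
  [fset v in pmap (@choice.unpickle V) (iota 0 n)]%fset.

Lemma mem_exhaustion n v : (choice.pickle v < n)%N -> v \in exhaustion n.
Proof.
move=> vn; rewrite inE mem_pmap; apply/mapP; exists (choice.pickle v).
  by rewrite mem_iota.
by rewrite choice.pickleK.
Qed.

Lemma exhaustion_mono n m : (n <= m)%N -> (exhaustion n `<=` exhaustion m)%fset.
Proof.
move=> nm; apply/fsubsetP => v; rewrite !inE !mem_pmap => /mapP[k].
rewrite mem_iota /= => kn vk; apply/mapP; exists k => //.
by rewrite mem_iota /= (leq_trans kn).
Qed.

Lemma exhaustion_cover (L : {fset V}) : exists n, (L `<=` exhaustion n)%fset.
Proof.
exists (\max_(v <- L) (choice.pickle v).+1)%N; apply/fsubsetP => v vL.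
by apply: mem_exhaustion; rewrite (big_rem v)//= leq_maxl.
Qed.

Lemma exhaustion_cvg : exhaustion n @[n --> \oo] `=>` fset_up V.
Proof.
move=> A [L _ LA]; have [n Ln] := exhaustion_cover L.
exists n => // m /= nm; apply: LA => /=.
exact: fsubset_trans Ln (exhaustion_mono nm).
Qed.

End Exhaustion.

(** The event depends on finitely many discrete coordinates, so its indicator is locally constant
    and is an admissible test function for [weak_limit]. *)
Lemma continuous_cylinder (R : realType) (V : countType) (F : {fset V}) c :
  continuous (\1_(cylinder F (fun=> [set c]) : set (V -> bool)) :
    {ptws V -> bool} -> R).
Proof.
move=> s; apply: cvg_near_cst; have Fs := nbhs_filter (s : {ptws V -> bool}).
have : \forall t \near (s : {ptws V -> bool}), forall v, v \in F -> t v = s v.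
  elim/fset1U_rect : F => [|v F _ IH]; first by apply: (@filterE _ _ Fs) => t v; rewrite inE.
  have vs : \forall t \near (s : {ptws V -> bool}), t v = s v.
    apply: (@proj_continuous V (fun=> bool) v s [set b | b = s v]).
    by apply: open_nbhs_nbhs; split => //; exact: discrete_open.
  apply: (@filterS2 _ _ Fs _ _ _ _ vs IH) => t tv tF w; rewrite !inE => /orP[/eqP ->//|].
  exact: tF.
apply: (@filterS _ _ Fs) => t ts; rewrite !indicE; congr (_%:R); congr nat_of_bool.
by apply/idP/idP => /set_mem h; apply/mem_set => v vF; have := h v vF; rewrite /= ts.
Qed.

Section LimitField.
Context {R : realType} {V : countType}.
Local Notation RR := (measurableTypeR R).
Local Notation P := (@iid_unif R V).
Variable J : {fset V} -> R.
Hypothesis J_ge0 : forall A : {fset V}, (#|` A| <= 2)%N -> 0 <= J A.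
Hypothesis J_summable : forall v : V,
  (\esum_(A in [set A : {fset V} | v \in A /\ (#|` A| <= 2)%N]) (J A)%:E
    < +oo)%E.
Implicit Types (L M F : {fset V}) (y : config V RR) (c : bool).

(** By [field_shrink] a spin that leaves [c] never returns as the window grows, so its limit is [c]
    exactly when every window gives [c]. *)
Definition limit_field c y : config V bool :=
  fun v => if `[< forall L, field J L c y v = c >] then c else ~~ c.

Lemma limit_fieldP c y v :
  limit_field c y v = c <-> forall L, field J L c y v = c.
Proof.
by rewrite /limit_field; case: asboolP => // h; split => //; case: (c).
Qed.

(** Reduces to countably many nested windows, as needed for measurability and for continuity from
    above. *)
Lemma limit_field_exhaustion c y v :
  limit_field c y v = c <-> forall n, field J (exhaustion n) c y v = c.
Proof.
split => [/limit_fieldP//|h]; apply/limit_fieldP => L.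
have [n Ln] := exhaustion_cover L.
exact: (field_shrink J_ge0 J_summable Ln).
Qed.

Lemma measurable_limit_field c : measurable_fun setT (limit_field c).
Proof.
apply: measurable_config => v; apply: (measurable_fun_bool c); rewrite setTI.
have -> : (fun y => limit_field c y v) @^-1` [set c] =
    \bigcap_n (field J (exhaustion n) c @^-1` [set s | s v = c]).
  apply/seteqP; split => [y /limit_field_exhaustion h n _|y h]; first exact: h.
  by apply/limit_field_exhaustion => n; exact: h.
by apply: bigcap_measurableType => n _; exact: measurable_field.
Qed.

(** Along the exhaustion, the probability that all spins of [F] equal [c] is evaluated in two ways:
    these events decrease to the one for the limit field, and the weak limit yields [mu]. Such
    events determine the law by [spin_measure_unique]. *)
Lemma limit_field_law c (mu : probability (config V bool) R) :
  weak_limit (fun L => ising_measure J L (fun=> c)) mu ->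
  forall A, measurable A -> P (limit_field c @^-1` A) = mu A.
Proof.
move=> mu_lim A mA; rewrite -(lawE P (measurable_limit_field c)).
apply: (spin_measure_unique (c := c)) => //.
  by apply: le_lt_trans (probability_le1 _ measurableT) _; exact: ltry.
move=> F; rewrite -[LHS]/(P (limit_field c @^-1` cylinder F (fun=> [set c]))).
pose C : set (config V bool) := cylinder F (fun=> [set c]).
have mC : measurable C by exact: measurable_cylinder.
pose A_ n := field J (exhaustion n) c @^-1` C.
have mA_ n : measurable (A_ n) by exact: measurable_field.
have capA : \bigcap_n A_ n = limit_field c @^-1` C.
  apply/seteqP; split => [y h v vF|y h n _ v vF].
    by apply/limit_field_exhaustion => n; exact: h.
  by move: (h v vF) => /limit_field_exhaustion; exact.
have cvg1 : (P \o A_) n @[n --> \oo] --> P (limit_field c @^-1` C).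
  rewrite -capA; apply: nonincreasing_cvg_mu => //.
  - by apply: le_lt_trans (probability_le1 _ _) _ => //; exact: ltry.
  - exact: bigcapT_measurable.
  - move=> n m nm; apply/subsetPset => y h v vF.
    by have := h v vF; exact/(field_shrink J_ge0 J_summable)/exhaustion_mono.
have cvg2 : fine (P (A_ n)) @[n --> \oo] --> fine (mu C).
  have := mu_lim \1_C (@continuous_cylinder R V F c).
  have bounded : exists M : R, forall s, `|\1_C s| <= M.
    by exists 1 => s; rewrite indicE; case: (_ \in _); rewrite ?normr0 ?normr1.
  move=> /(_ bounded).
  have intE (m : {measure set (config V bool) -> \bar R}) :
      \int[m]_x \1_C x = fine (m C).
    by rewrite /Rintegral integral_indic// setIT.
  rewrite intE => /(cvg_comp _ _ exhaustion_cvg).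
  rewrite (_ : _ \o _ = fun n => fine (P (A_ n)))//.
  apply/funext => n /=; rewrite intE; congr fine.
  exact/esym/(field_law J_ge0 J_summable).
have Pfin E : measurable E -> P E \is a fin_num by move=> mE; exact: fin_num_measure.
have mlC : measurable (limit_field c @^-1` C).
  exact: (measurable_preimage (measurable_limit_field c)).
have cvg3 : fine (P (A_ n)) @[n --> \oo] --> fine (P (limit_field c @^-1` C)).
  by apply: fine_cvg; rewrite fineK// Pfin.
rewrite -[LHS]fineK ?Pfin// -[RHS]fineK ?fin_num_measure//; congr EFin.
exact: (cvg_unique _ cvg3 cvg2).
Qed.

End LimitField.

(** * Equivariance *)

Section Ties.
Context {R : realType} {V : countType}.
Local Notation RR := (measurableTypeR R).
Local Notation P := (@iid_unif R V).
Implicit Types (y : config V RR).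

Definition no_ties : set (config V RR) := [set y | injective (labels y)].

Let tie (n : nat) : set (config V RR) :=
  if @choice.unpickle (V * V)%type n is Some ab then
    if ab.1 == ab.2 then set0 else [set y | labels y ab.1 = labels y ab.2]
  else set0.

Let no_tiesE : ~` no_ties = \bigcup_n tie n.
Proof.
apply/seteqP; split => y.
  move=> yt; apply: contrapT => nt; apply: yt => a b ab; apply: contrapT => nab.
  apply: nt; exists (choice.pickle (a, b)) => //.
  by rewrite /tie choice.pickleK /=; case: eqP.
move=> [n _]; rewrite /tie; case: choice.unpickle => // -[a b] /=.
by case: eqP => // nab /= yab yi; apply: nab; exact: yi.
Qed.

Let measurable_tie n : measurable (tie n).
Proof.
rewrite /tie; case: choice.unpickle => // -[a b] /=; case: ifP => // _.
exact: measurable_labels_tie.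
Qed.

Lemma measurable_no_ties : measurable no_ties.
Proof.
by rewrite -(setCK no_ties) no_tiesE; apply/measurableC/bigcupT_measurable.
Qed.

Lemma no_ties_full : P no_ties = 1%E.
Proof.
have h : P (~` no_ties) = 0%E.
  apply/eqP; rewrite -measure_le0 no_tiesE.
  apply: le_trans (generalized_Boole_inequality _ _ _) _ => //.
    exact: bigcupT_measurable.
  rewrite eseries0// => n _ _; rewrite /tie; case: choice.unpickle => [[a b]/=|].
    by case: eqP => [_|/eqP ab]; [exact: measure0|exact: labels_tie_null].
  exact: measure0.
rewrite -(setCK no_ties) probability_setC; first by rewrite h sube0.
by apply: measurableC; exact: measurable_no_ties.
Qed.

End Ties.

Section Equivariance.
Context {R : realType} {V : countType}.
Local Notation RR := (measurableTypeR R).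
Local Notation P := (@iid_unif R V).
Variables (f g : V -> V).
Hypotheses (fK : cancel f g) (gK : cancel g f).
Implicit Types (L : {fset V}) (y : config V RR) (c : bool).

Lemma measurable_comp_index d (T : measurableType d) :
  measurable_fun setT (fun y : config V T => (y \o g : config V T)).
Proof. by apply: measurable_config => v; exact: measurable_coord. Qed.

Lemma iid_unif_comp (A : set (config V RR)) : measurable A ->
  P ((fun y => y \o g : config V RR) @^-1` A) = P A.
Proof.
move=> mA; rewrite -[LHS](lawE P (@measurable_comp_index _ RR)).
apply: (cylinder_measure_unique _ _ mA) => [|F B mB].
  by apply: le_lt_trans (probability_le1 _ measurableT) _; exact: ltry.
rewrite -[LHS]/(P ((fun y => y \o g : config V RR) @^-1` cylinder F B)).
have -> : (fun y => y \o g : config V RR) @^-1` cylinder F B =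
    cylinder [fset g v | v in F]%fset (B \o f).
  apply/seteqP; split => [y yF _ /imfsetP[v /= vF ->]|y yF v vF].
    by rewrite /= gK; exact: yF.
  rewrite /= -[in B v](gK v); apply: (yF (g v)).
  by apply/imfsetP; exists v.
rewrite iid_unif_cylinder; last by move=> v; exact: mB.
apply/esym/(etrans (iid_unif_cylinder F mB)).
rewrite big_imfset/=; last by move=> a b _ _; exact: (can_inj gK).
by apply: eq_bigr => v _; rewrite gK.
Qed.

Lemma no_ties_comp y : no_ties (y \o g) <-> no_ties y.
Proof.
split => yi a b yab.
  by apply: (can_inj fK); apply: yi; rewrite /labels /= !fK.
by apply: (can_inj gK); exact: yi.
Qed.

(** Without ties the enumeration of [V] never decides between distinct vertices, so the order is
    carried along by [f]. *)
Lemma arranged_map y L : no_ties y ->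
  arranged (labels (y \o g)) [fset f v | v in L]%fset =
  map f (arranged (labels y) L).
Proof.
move=> yi; apply/arrangedP.
  apply: uniq_perm.
  - by rewrite map_inj_uniq ?uniq_arranged//; exact: can_inj fK.
  - exact: fset_uniq.
  - move=> v; apply/mapP/imfsetP => -[w wL ->]; exists w => //.
      by rewrite -(mem_arranged (labels y)).
    by rewrite mem_arranged.
rewrite sorted_map; have : sorted (prec (labels y)) (arranged (labels y) L).
  exact/sort_sorted/prec_total.
apply: sub_sorted => a b; rewrite /prec /labels /= !fK.
case/orP => [->//|/andP[/eqP /yi -> _]]; by rewrite eqxx leqnn orbT.
Qed.

Variable J : {fset V} -> R.
Hypothesis J_ge0 : forall A : {fset V}, (#|` A| <= 2)%N -> 0 <= J A.
Hypothesis J_summable : forall v : V,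
  (\esum_(A in [set A : {fset V} | v \in A /\ (#|` A| <= 2)%N]) (J A)%:E
    < +oo)%E.
Hypothesis J_map : forall A : {fset V}, (#|` A| <= 2)%N ->
  J [fset f v | v in A]%fset = J A.

Lemma field_map L c y : no_ties y ->
  field J [fset f v | v in L]%fset c (y \o g) = field J L c y \o g.
Proof.
move=> yi; rewrite /field /reveal arranged_map//.
have Wm l s : window_weight J (map f l) (s \o g) = window_weight J l s.
  exact: window_weight_map.
by have := sample_map fK gK Wm (arranged (labels y) L) (fun=> c) (heights y).
Qed.

Lemma limit_field_map c y : no_ties y ->
  limit_field J c (y \o g) = limit_field J c y \o g.
Proof.
move=> yi; apply/funext => v.
have E : limit_field J c (y \o g) v = c <-> limit_field J c y (g v) = c.
  split => /limit_fieldP h; apply/limit_fieldP => L.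
    by have := h [fset f w | w in L]%fset; rewrite field_map.
  have -> : L = [fset f w | w in [fset g w | w in L]]%fset.
    apply/fsetP => w; apply/idP/imfsetP => [wL|[_ /imfsetP[x /= xL ->] ->]].
      by exists (g w); rewrite ?gK//; apply/imfsetP; exists w.
    by rewrite gK.
  by rewrite field_map//; exact: h.
rewrite /=; move: (limit_field J c (y \o g) v) (limit_field J c y (g v)) E => p q.
by move: p q c => [] [] [] [h1 h2] //; (have := h1 erefl) || (have := h2 erefl).
Qed.

End Equivariance.

(** * The coding from independent uniform variables *)

Section Fiid.
Context {R : realType} {V : countType}.
Local Notation RR := (measurableTypeR R).
Local Notation P := (@iid_unif R V).
Variable J : {fset V} -> R.
Hypothesis J_ge0 : forall A : {fset V}, (#|` A| <= 2)%N -> 0 <= J A.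
Hypothesis J_summable : forall v : V,
  (\esum_(A in [set A : {fset V} | v \in A /\ (#|` A| <= 2)%N]) (J A)%:E
    < +oo)%E.
Context (Gamma : groupType) (act : Gamma -> V -> V).
Hypothesis act_action : is_group_action act.
Hypothesis J_act : forall g (A : {fset V}), (#|` A| <= 2)%N ->
  J [fset act g v | v in A]%fset = J A.

Let actK g : cancel (act g) (act g^-1).
Proof. by case: act_action => a1 aM v; rewrite -aM mulVg a1. Qed.

Let actVK g : cancel (act g^-1) (act g).
Proof. by case: act_action => a1 aM v; rewrite -aM mulgV a1. Qed.

Lemma limit_field_coding c (mu : probability (config V bool) R) :
  weak_limit (fun L => ising_measure J L (fun=> c)) mu ->
  coding act P mu (limit_field J c).
Proof.
move=> mu_lim.
have mlf := measurable_limit_field J_ge0 J_summable c.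
have lawP := limit_field_law J_ge0 J_summable mu_lim.
have iP : invariant_law act P.
  by move=> g A mA; exact: (iid_unif_comp (actVK g)).
have equi g y : no_ties y ->
    limit_field J c (Defs.shift act g y) = Defs.shift act g (limit_field J c y).
  by move=> yi; exact: (limit_field_map (actK g) (actVK g) J_ge0 J_summable (J_act g)).
split => //.
(* Invariance of [mu] is inherited from [P] through the law of the limit field and its equivariance
   off ties; both events are first intersected with the full event [no_ties]. *)
- move=> g A mA.
  have mS d (T : measurableType d) : measurable_fun setT
      (Defs.shift act g : config V T -> config V T).
    exact: measurable_comp_index.
  have mSA : measurable (Defs.shift act g @^-1` A : set (config V bool)).
    exact: (measurable_preimage (mS _ _)).
  have mlfA (B : set (config V bool)) :
      measurable B -> measurable (limit_field J c @^-1` B : set (config V RR)).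
    by move=> mB; exact: (measurable_preimage mlf).
  rewrite -lawP// -[RHS]lawP// -[RHS](iP g); last exact: mlfA.
  rewrite -(probability_setI_full measurable_no_ties (mlfA _ mSA) no_ties_full).
  rewrite -[RHS](probability_setI_full measurable_no_ties _ no_ties_full); last first.
    by apply: (measurable_preimage (mS _ _)); exact: mlfA.
  by congr (P _); apply/seteqP; split => y [/= h yi]; split => //;
    move: h; rewrite /= equi.
- exists no_ties; split.
  + exact: measurable_no_ties.
  + exact: no_ties_full.
  + move=> g; apply/seteqP; split => y yi;
      exact/(no_ties_comp (actK g) (actVK g) y).
  + by move=> g y; exact: equi.
Qed.

Lemma limit_field_fiid c (mu : probability (config V bool) R) :
  weak_limit (fun L => ising_measure J L (fun=> c)) mu -> fiid act mu.
Proof.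
move=> mu_lim; exists _, RR, P, (limit_field J c); split.
- exact: standard_borel_real.
- exact: iid_law_unif.
- exact: limit_field_coding.
Qed.

End Fiid.

(** * Finite coding radius *)

Section Finitary.
Context {R : realType} {V : countType}.
Local Notation RR := (measurableTypeR R).
Local Notation P := (@iid_unif R V).
Variable J : {fset V} -> R.
Hypothesis J_ge0 : forall A : {fset V}, (#|` A| <= 2)%N -> 0 <= J A.
Hypothesis J_summable : forall v : V,
  (\esum_(A in [set A : {fset V} | v \in A /\ (#|` A| <= 2)%N]) (J A)%:E
    < +oo)%E.
Implicit Types (L : {fset V}) (y : config V RR) (c : bool).

Lemma sample_local (p : V -> seq V -> (V -> bool) -> R) l t (u u' : V -> R) :
  {in l, u =1 u'} -> sample p l t u = sample p l t u'.
Proof.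
elim: l t => //= v l IH t uu'; rewrite uu' ?mem_head//.
by apply: IH => w wl; apply: uu'; rewrite inE wl orbT.
Qed.

Lemma field_local L c y y' : {in L, y =1 y'} -> field J L c y = field J L c y'.
Proof.
move=> yy'; have -> : field J L c y = reveal J (arranged (labels y') L) c y.
  rewrite /field; congr reveal; apply/arrangedP; first exact: perm_arranged.
  have aL : all (mem L) (arranged (labels y') L).
    by apply/allP => v; rewrite mem_arranged.
  rewrite (eq_in_sorted _ aL (e' := prec (labels y'))).
    exact/sort_sorted/prec_total.
  by move=> a b aL' bL'; rewrite /prec /labels !yy'.
by apply: sample_local => v; rewrite mem_arranged /heights => /yy' ->.
Qed.

(** If the common spin is +, some window with - boundary already shows +. It still does for every
    [y'] agreeing on that window, and it lies below all + windows of [y']. If the common spin is -,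
    some window with + boundary shows -, which forces the limit for every such [y']. *)
Lemma limit_field_decided y v :
  limit_field J true y v = limit_field J false y v ->
  exists L, forall y', {in L, y' =1 y} ->
    limit_field J true y v = limit_field J true y' v.
Proof.
case: (boolP (limit_field J true y v)) => ty /esym fy.
- have [L yL] : exists L, field J L false y v.
    apply: contrapT => nL; have : limit_field J false y v = false.
      apply/limit_fieldP => L; apply/negP => yL; apply: nL; by exists L.
    by rewrite fy.
  exists L => y' /(field_local false) yy'; apply/esym/limit_fieldP => M.
  by have /implyP := field_false_le_true J_ge0 J_summable L M y' v; rewrite yy'; apply.
- have [L yL] : exists L, ~~ field J L true y v.
    apply: contrapT => nL; move/negP: ty; apply; apply/limit_fieldP => L.
    by apply/negPn/negP => yL; apply: nL; exists L.
  exists L => y' /(field_local true) yy'; apply/esym/negP => /limit_fieldP/(_ L).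
  by rewrite yy'; exact/negP.
Qed.

Variable e : rel V.
Hypothesis e_connected : graph_connected e.

(** Connectedness makes each distance finite, hence the maximum over the finite set as well. *)
Lemma fset_sub_ball v L : exists r : nat,
  forall w, w \in L -> (gdist e R v w <= r%:R%:E)%E.
Proof.
elim/fset1U_rect : L => [|x L _ [r rL]]; first by exists 0%N => w; rewrite inE.
have [p pv px] := e_connected v x.
exists (maxn (size p) r) => w; rewrite !inE => /orP[/eqP ->|/rL wr].
  apply: (@le_trans _ _ (size p)%:R%:E).
    by apply: ereal_inf_lbound; exists p.
  by rewrite lee_fin ler_nat leq_maxl.
by apply: le_trans wr _; rewrite lee_fin ler_nat leq_maxr.
Qed.

Lemma coding_radius_fin y v :
  limit_field J true y v = limit_field J false y v ->
  (coding_radius R e (limit_field J true) v y < +oo)%E.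
Proof.
move=> /limit_field_decided[L yL]; have [r rL] := fset_sub_ball v L.
apply: (@le_lt_trans _ _ (r%:R%:E : \bar R)); last exact: ltry.
apply: ereal_inf_lbound; exists r => // y' yy'.
by apply: yL => w wL; apply: yy'; exact: rL.
Qed.

(** A + at [v] has the same probability in both limits, and the event for the - limit is contained
    in that for the + limit. Their difference is therefore null, and off it the limits agree at [v],
    so the radius is finite. *)
Lemma limit_field_finitary (mup mum : probability (config V bool) R) :
  weak_limit (fun L => ising_measure J L (fun=> true)) mup ->
  weak_limit (fun L => ising_measure J L (fun=> false)) mum ->
  (forall B, measurable B -> mup B = mum B) ->
  finitary e P (limit_field J true).
Proof.
move=> mup_lim mum_lim mu_eq; exists (limit_field J true); split.
- exact: measurable_limit_field.
- exact: aeW.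
move=> v; pose S c := limit_field J c @^-1` [set s : config V bool | s v].
have mv : measurable [set s : config V bool | s v].
  exact: (measurable_preimage (measurable_coord v) (A := [set b : bool | b])).
have mS c : measurable (S c).
  exact: (measurable_preimage (measurable_limit_field J_ge0 J_summable c)).
have PS : P (S true) = P (S false).
  by rewrite /S (limit_field_law J_ge0 J_summable mup_lim) //
    (limit_field_law J_ge0 J_summable mum_lim)// mu_eq.
have Sft : S false `<=` S true.
  move=> y fy; apply/limit_fieldP => M; apply: contrapT => nM.
  have : limit_field J false y v = false.
    apply/limit_fieldP => L; apply/negP => yL; apply: nM.
    by have /implyP := field_false_le_true J_ge0 J_summable L M y v; apply.
  by move: fy => /= ->.
exists (S true `\` S false); split.
- exact: measurableD.
- rewrite measureD//; last by apply: le_lt_trans (probability_le1 _ _) _; rewrite ?ltry.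
  rewrite setIidr//; transitivity (P (S true) - P (S false))%E => //.
  by rewrite PS subee// fin_num_measure//; exact: mS.
- move=> y; apply: contraPP => /= yD ny; apply: ny; apply: coding_radius_fin.
  apply/idP/idP => h; last exact: Sft.
  by apply: contrapT => nf; apply: yD.
Qed.

End Finitary.

Theorem theorem6 (R : realType) (V : countType) (e : rel V)
    (e_sym : symmetric e) (e_irr : irreflexive e)
    (V_infinite : infinite_set [set: V]) (e_lf : locally_finite e)
    (e_qt : quasi_transitive (automorphism e))
    (J : {fset V} -> R)
    (J_ge0 : forall A : {fset V}, (#|` A| <= 2)%N -> 0 <= J A)
    (J_summable : forall v : V,
      (\esum_(A in [set A : {fset V} | v \in A /\ (#|` A| <= 2)%N]) (J A)%:E < +oo)%E)
    (J_invariant : forall (f : V -> V) (A : {fset V}), automorphism e f -> (#|` A| <= 2)%N ->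
      J [fset f v | v in A]%fset = J A)
    (mup mum : probability (config V bool) R)
    (mup_plus : is_plus_ising J mup) (mum_minus : is_minus_ising J mum)
    (Gamma : groupType) (act : Gamma -> V -> V)
    (act_action : is_group_action act)
    (act_aut : forall g, automorphism e (act g))
    (act_qt : quasi_transitive (range act)) :
  [/\ fiid act mup, fiid act mum &
      graph_connected e ->
      (forall B, measurable B -> mup B = mum B) -> ffiid act e mup].
Proof.
have J_act g (A : {fset V}) : (#|` A| <= 2)%N -> J [fset act g v | v in A]%fset = J A.
  exact: J_invariant.
have fiid_of := limit_field_fiid J_ge0 J_summable act_action J_act.
split; [exact: fiid_of mup_plus|exact: fiid_of mum_minus|].
move=> e_conn mu_eq.
exists _, (measurableTypeR R), (@iid_unif R V), (limit_field J true); split.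
- exact: standard_borel_real.
- exact: iid_law_unif.
- exact: (limit_field_coding J_ge0 J_summable act_action J_act mup_plus).
- exact: (limit_field_finitary J_ge0 J_summable e_conn mup_plus mum_minus mu_eq).
Qed.
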